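(* For every constant $\varepsilon>0$ there is a randomized algorithm which, given a set $S$ of $n$ points in $\mathbb{R}^3$ and a point $y\in\mathbb{R}^3$, returns two points $a,b\in S$ such that the Euclidean distance from $y$ to the line through $a$ and $b$ is at most $(1+\varepsilon)$ times the minimum, over all pairs of distinct points $a',b'\in S$, of the distance from $y$ to the line through $a'$ and $b'$. With high probability the algorithm runs in time $O_{\varepsilon}(n\log^3 n)$.
   Context: This is the nearest induced line problem in $\mathbb{R}^3$. The distance from a point to a line is the Euclidean distance to the closest point of the line. $O_\varepsilon$ hides factors depending only on $\varepsilon$. *)

(* Defs.v *)
From Stdlib Require List.
From HB Require Import structures.
From mathcomp Require Import all_boot all_order all_algebra.
From mathcomp Require Import all_classical all_reals all_analysis.
Set Implicit Arguments.
Unset Strict Implicit.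
Unset Printing Implicit Defensive.
Import Order.TTheory GRing.Theory Num.Theory.
Local Open Scope classical_set_scope.
Local Open Scope ring_scope.

(* The norm `|u| on 'rV[R]_3 is the sup norm. *)
Definition enorm (R : realType) (u : 'rV[R]_3) : R :=
  Num.sqrt (\sum_(i < 3) u 0 i ^+ 2).

Definition line (R : realType) (a b : 'rV[R]_3) : set 'rV[R]_3 :=
  [set p | exists t : R, p = a + t *: (b - a)].

Definition dist_line (R : realType) (y a b : 'rV[R]_3) : R :=
  inf [set enorm (y - p) | p in line a b].

(* The set below is finite, and nonempty once s has two distinct points, so
   that its infimum is then a minimum. *)
Definition min_induced_dist (R : realType) (s : seq 'rV[R]_3)
    (y : 'rV[R]_3) : R :=
  inf [set d | exists a b : 'rV[R]_3,
         [/\ a \in s, b \in s, a != b & d = dist_line y a b]].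

(* The model of computation is the randomized real RAM.  There are two
   unbounded memories addressed by natural numbers, one of machine words and
   one of real numbers, and the first cells of each play the role of registers.
   Each instruction costs one time unit.  The real unit computes exactly
   + - * / and square roots and compares; there is no rounding, so that
   information flows from reals to words through comparisons only, and the only
   literals in a program are natural numbers.
   A program is structured (while loops) rather than a list with jumps. *)

Inductive iop := IAdd | ISub | IMul | IDiv | IMod.
Inductive rop := RAdd | RSub | RMul | RDiv.

(* In an assignment the first argument is the destination.  Writing w and r for
   the two memories, [ILoad d a] is w[d] := w[w[a]], [IStore d a] is
   w[w[d]] := w[a], [RLoad d a] is r[d] := r[w[a]], [RStore d a] is
   r[w[d]] := r[a], and [RofI d a] is r[d] := w[a]. *)
Inductive instr :=
  | IConst of nat & nat
  | IArith of iop & nat & nat & nat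
  | ILoad of nat & nat
  | IStore of nat & nat
  | IRand of nat & nat (* w[d] := uniformly random in {0, ..., w[a] - 1} *)
  | RofI of nat & nat
  | RArith of rop & nat & nat & nat
  | RSqrt of nat & nat
  | RLoad of nat & nat
  | RStore of nat & nat.

Inductive test :=
  | ILe of nat & nat
  | RLe of nat & nat.

Inductive cmd :=
  | Skip
  | Do of instr
  | Seq of cmd & cmd
  | If of test & cmd & cmd
  | While of test & cmd.

Record mem (R : realType) := Mem { word : nat -> nat; real : nat -> R }.

Definition upd (T : Type) (f : nat -> T) (d : nat) (v : T) : nat -> T :=
  fun k => if k == d then v else f k.

Definition setw (R : realType) (m : mem R) (d v : nat) : mem R :=
  Mem (upd (word m) d v) (real m).

Definition setr (R : realType) (m : mem R) (d : nat) (v : R) : mem R :=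
  Mem (word m) (upd (real m) d v).

(* As in MathComp, word subtraction is truncated at 0 and division by 0, like
   the square root of a negative real, is total. *)
Definition eval_iop (o : iop) (x y : nat) : nat :=
  match o with
  | IAdd => x + y
  | ISub => x - y
  | IMul => x * y
  | IDiv => x %/ y
  | IMod => x %% y
  end%N.

Definition eval_rop (R : realType) (o : rop) (x y : R) : R :=
  match o with
  | RAdd => x + y
  | RSub => x - y
  | RMul => x * y
  | RDiv => x / y
  end.

Definition eval_test (R : realType) (b : test) (m : mem R) : bool :=
  match b with
  | ILe x y => (word m x <= word m y)%N
  | RLe x y => real m x <= real m y
  end.

(* The equally likely memories after an instruction; W is the number of values
   of a machine word.  The empty list is a fault, from which the machine never
   halts: it is caused by a result that does not fit in a word, and by a random
   choice in the empty range. *)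
Definition exec (R : realType) (W : nat) (i : instr) (m : mem R) :
    seq (mem R) :=
  let guard v d := if (v < W)%N then [:: setw m d v] else [::] in
  match i with
  | IConst d k => guard k d
  | IArith o d x y => guard (eval_iop o (word m x) (word m y)) d
  | ILoad d a => [:: setw m d (word m (word m a))]
  | IStore d a => [:: setw m (word m d) (word m a)]
  | IRand d a => [seq setw m d v | v <- iota 0 (word m a)]
  | RofI d a => [:: setr m d (word m a)%:R]
  | RArith o d x y => [:: setr m d (eval_rop o (real m x) (real m y))]
  | RSqrt d a => [:: setr m d (Num.sqrt (real m a))]
  | RLoad d a => [:: setr m d (real m (word m a))]
  | RStore d a => [:: setr m (word m d) (real m a)]
  end.

(* A stack of commands still to be executed, and the current memory.  The
   machine has halted when the stack is empty. *)
Definition config (R : realType) := (seq cmd * mem R)%type.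

(* The equally likely successors of a configuration. *)
Definition step (R : realType) (W : nat) (c : config R) : seq (config R) :=
  let: (st, m) := c in
  match st with
  | [::] => [::]
  | Skip :: k => [:: (k, m)]
  | Do i :: k => [seq (k, m') | m' <- exec W i m]
  | Seq p q :: k => [:: (p :: q :: k, m)]
  | If b p q :: k => [:: ((if eval_test b m then p else q) :: k, m)]
  | While b p :: k =>
      [:: (if eval_test b m then p :: While b p :: k else k, m)]
  end.

(* [returns W c m]: some sequence of random choices leads from c to a halt with
   final memory m. *)
Inductive returns (R : realType) (W : nat) : config R -> mem R -> Prop :=
  | returns_halt (m : mem R) : returns W ([::], m) m
  | returns_step (c c' : config R) (m : mem R) :
      List.In c' (step W c) -> returns W c' m -> returns W c m.

(* The probability, over the random choices, that the machine started in c
   halts within t steps.  After a fault the mean is over the empty list and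
   equals 0 / 0 = 0. *)
Fixpoint halt_prob (R : realType) (W t : nat) (c : config R) : R :=
  if c.1 is [::] then 1 else
  if t is t'.+1 then
    (\sum_(c' <- step W c) halt_prob W t' c') / (size (step W c))%:R
  else 0.

(* On inputs of n points, words have kappa * ceil(log2 n) bits. *)
Definition word_range (kappa n : nat) : nat := (2 ^ (kappa * up_log 2 n))%N.

(* Initially w[0] is the number of points, and the coordinates of y and then of
   the points, three by three, occupy the first real cells; all the other cells
   contain 0. *)
Definition input_mem (R : realType) (s : seq 'rV[R]_3) (y : 'rV[R]_3) :
    mem R :=
  Mem (fun k => if k == 0%N then size s else 0%N)
      (fun k => (y :: s)`_(k %/ 3) 0 (inord (k %% 3))).

(* The two output points, for j = 0 and j = 1, are read from r[0], ..., r[5]. *)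
Definition output_point (R : realType) (m : mem R) (j : nat) : 'rV[R]_3 :=
  \row_(i < 3) real m (3 * j + i)%N.

Definition start (R : realType) (P : cmd) (s : seq 'rV[R]_3) (y : 'rV[R]_3) :
    config R :=
  ([:: P], input_mem s y).

(* The answer is correct whatever the random choices are. *)
Definition approximates_nearest_line (R : realType) (eps : R) (P : cmd)
    (kappa : nat) : Prop :=
  forall (s : seq 'rV[R]_3) (y : 'rV[R]_3) (m : mem R),
    uniq s -> (2 <= size s)%N ->
    returns (word_range kappa (size s)) (start P s y) m ->
    let a := output_point m 0 in
    let b := output_point m 1 in
    [/\ a \in s, b \in s, a != b &
        dist_line y a b <= (1 + eps) * min_induced_dist s y].

(* Running time O(T n) with high probability: for each exponent c, the
   probability of exceeding K * T n steps is at most n^-c, where K depends on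
   c but neither on n nor on the input. *)
Definition runs_in_whp (R : realType) (T : nat -> R) (P : cmd)
    (kappa : nat) : Prop :=
  forall c : nat, exists K : R,
    forall (s : seq 'rV[R]_3) (y : 'rV[R]_3),
      uniq s -> (2 <= size s)%N ->
      exists t : nat,
        t%:R <= K * T (size s) /\
        1 - (size s)%:R ^- c <=
          halt_prob (word_range kappa (size s)) t (start P s y).

(* Main.v *)
Require Import Defs.
From mathcomp Require Import all_boot all_order all_algebra.
From mathcomp Require Import all_classical all_reals all_analysis.
From mathcomp Require Import zify ring lra.
Import Order.TTheory GRing.Theory Num.Theory.
Local Open Scope ring_scope.
Set Implicit Arguments.
Unset Strict Implicit.
Unset Printing Implicit Defensive.

(* The algorithm is deterministic and takes O(n log n) steps.  Let y = 0 and let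
   u be a vector.  With X_p = p / (u . p) and rho_p = 1 / (u . p), the line
   through a and b meets the plane u . x = 0 at (X_b - X_a) / (rho_b - rho_a).
   The norm of this point is at least the distance from 0 to the line, and at
   most 1 + O(1/N) times that distance if u is within an angle O(1/N) of the
   direction b - a; so it suffices to minimize |X_b - X_a| / |rho_b - rho_a| for
   each u in a finite net.  As in a Lipschitz constant, the minimum over all
   pairs is approximated by the minimum over the edges of a (1 + eps)-spanner of
   the points X_p of the plane u . x = 1.  The spanner is a theta graph, in which
   a is joined to its nearest neighbour c in each cone a + C.  For a cone given
   by g1 . z >= 0 and g2 . z >= 0, with (g1 + g2) . z measuring nearness, c is
   found by sorting the points by g1 and then merge sorting them by decreasing
   g2: at the merge where a is in the left run and c in the right one, c
   minimizes g1 + g2 among the elements of the right run merged before a. *)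

(** * The machine *)

Section Machine.
Variables (R : realType) (W : nat).
Local Notation mem := (Defs.mem R).

Fixpoint dsteps (t : nat) (c c' : config R) : Prop :=
  if t is t'.+1 then exists2 c1, step W c = [:: c1] & dsteps t' c1 c'
  else c = c'.

Lemma dsteps_trans t1 t2 c1 c2 c3 :
  dsteps t1 c1 c2 -> dsteps t2 c2 c3 -> dsteps (t1 + t2) c1 c3.
Proof.
elim: t1 c1 => [|t1 IH] c1 /= => [-> //|[c e d] d2].
by exists c => //; exact: IH.
Qed.

Lemma dsteps_returns t c c' m :
  dsteps t c c' -> returns W c m -> returns W c' m.
Proof.
elim: t c => [|t IH] c /= => [-> //|[c1 e d] r].
apply: IH d _; case: r e => [m0 //|c0 c2 m0 + r] e.
by rewrite e => /= -[->|].
Qed.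

Lemma dsteps_halt t c m :
  dsteps t c ([::], m) -> halt_prob W t c = 1.
Proof.
elim: t c => [|t IH] c /= => [-> //|[c1 e d]].
case: c e => -[|p k] m0 e //; rewrite /= in e *.
by rewrite e big_seq1 divr1; exact: IH.
Qed.

Lemma returns_nil (m m' : mem) : returns W ([::], m) m' -> m' = m.
Proof. by move=> H; inversion H; subst. Qed.

Definition ev (c : cmd) (m : mem) (t : nat) (m' : mem) : Prop :=
  forall k, dsteps t (c :: k, m) (k, m').

Lemma ev_skip m : ev Skip m 1 m.
Proof. by move=> k; exists (k, m). Qed.

Lemma ev_do i m m' : exec W i m = [:: m'] -> ev (Do i) m 1 m'.
Proof. by move=> e k; exists (k, m') => //=; rewrite e. Qed.

Lemma ev_seq p q m t1 m1 t2 m2 :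
  ev p m t1 m1 -> ev q m1 t2 m2 -> ev (Seq p q) m (t1 + t2).+1 m2.
Proof.
by move=> e1 e2 k; exists (p :: q :: k, m) => //; exact: dsteps_trans (e1 _) _.
Qed.

Lemma ev_if b p q m t m' :
  ev (if eval_test b m then p else q) m t m' -> ev (If b p q) m t.+1 m'.
Proof. by move=> e k; eexists; [reflexivity | exact: e]. Qed.

Lemma ev_while b p m t1 m1 t2 m2 : eval_test b m ->
  ev p m t1 m1 -> ev (While b p) m1 t2 m2 -> ev (While b p) m (t1 + t2).+1 m2.
Proof.
move=> eb e1 e2 k; exists (p :: While b p :: k, m); first by rewrite /= eb.
exact: dsteps_trans (e1 _) _.
Qed.

Lemma ev_while_end b p m : ~~ eval_test b m -> ev (While b p) m 1 m.
Proof. by move=> eb k; exists (k, m) => //=; rewrite (negbTE eb). Qed.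

(* Cells below 32 are variables, cells 32 to 63 scratch, and entry i of array
   c < 8 is the cell 64 + 8 i + c; this holds for both memories. *)
Record hst := Hst {
  wv : nat -> nat; wa : nat -> nat -> nat;
  rv : nat -> R; ra : nat -> nat -> R }.

Definition cell (c i : nat) : nat := (64 + c + 8 * i)%N.

Definition abs (m : mem) : hst :=
  Hst (fun x => if (x < 32)%N then word m x else 0%N)
      (fun c i => if (c < 8)%N then word m (cell c i) else 0%N)
      (fun x => if (x < 32)%N then real m x else 0)
      (fun c i => if (c < 8)%N then real m (cell c i) else 0).

Definition upd2 (T : Type) (f : nat -> nat -> T) (c i : nat) (v : T) :=
  fun c' i' => if (c' == c) && (i' == i) then v else f c' i'.

Definition setwv h x v := Hst (upd (wv h) x v) (wa h) (rv h) (ra h).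
Definition setwa h c i v := Hst (wv h) (upd2 (wa h) c i v) (rv h) (ra h).
Definition setrv h x v := Hst (wv h) (wa h) (upd (rv h) x v) (ra h).
Definition setra h c i v := Hst (wv h) (wa h) (rv h) (upd2 (ra h) c i v).

Lemma hst_eq h h' : wv h =1 wv h' -> wa h =2 wa h' -> rv h =1 rv h' ->
  ra h =2 ra h' -> h = h'.
Proof.
case: h h' => [a b c d] [a' b' c' d'] /= /funext-> E2 /funext-> E4.
by congr Hst; apply/funext => i; apply/funext => j.
Qed.

Lemma abs_setwv m x v : (x < 32)%N -> abs (setw m x v) = setwv (abs m) x v.
Proof.
move=> x32; apply: hst_eq => //= [k|c i]; rewrite /upd.
  by case: eqP => // ->; rewrite x32.
by case: ifP => // c8; case: eqP => //; rewrite /cell; lia.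
Qed.

Lemma abs_setrv m x v : (x < 32)%N -> abs (setr m x v) = setrv (abs m) x v.
Proof.
move=> x32; apply: hst_eq => //= [k|c i]; rewrite /upd.
  by case: eqP => // ->; rewrite x32.
by case: ifP => // c8; case: eqP => //; rewrite /cell; lia.
Qed.

Lemma abs_setwa m c i v : (c < 8)%N ->
  abs (setw m (cell c i) v) = setwa (abs m) c i v.
Proof.
move=> c8; apply: hst_eq => //= [k|c' i']; rewrite /upd /upd2.
  by case: ifP => // k32; case: eqP => //; rewrite /cell; lia.
case: (altP andP) => [[/eqP-> /eqP->]|ne]; first by rewrite c8 eqxx.
by case: ifP => // c8'; case: eqP => // e; case/negP: ne; apply/andP;
  rewrite /cell in e; split; apply/eqP; lia.
Qed.

Lemma abs_setra m c i v : (c < 8)%N ->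
  abs (setr m (cell c i) v) = setra (abs m) c i v.
Proof.
move=> c8; apply: hst_eq => //= [k|c' i']; rewrite /upd /upd2.
  by case: ifP => // k32; case: eqP => //; rewrite /cell; lia.
case: (altP andP) => [[/eqP-> /eqP->]|ne]; first by rewrite c8 eqxx.
by case: ifP => // c8'; case: eqP => // e; case/negP: ne; apply/andP;
  rewrite /cell in e; split; apply/eqP; lia.
Qed.

Definition scratch x := (32 <= x < 64)%N.

Lemma abs_scratchw m x v : scratch x -> abs (setw m x v) = abs m.
Proof.
move=> /andP[x1 x2]; apply: hst_eq => //= [k|c i]; rewrite /upd.
  by case: ifP => // k32; case: eqP => //; lia.
by case: ifP => // c8; case: eqP => //; rewrite /cell; lia.
Qed.

Lemma abs_scratchr m x v : scratch x -> abs (setr m x v) = abs m.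
Proof.
move=> /andP[x1 x2]; apply: hst_eq => //= [k|c i]; rewrite /upd.
  by case: ifP => // k32; case: eqP => //; lia.
by case: ifP => // c8; case: eqP => //; rewrite /cell; lia.
Qed.

Fixpoint tc (c : cmd) : nat :=
  match c with
  | Seq p q => (tc p + tc q).+1
  | If _ p q => (tc p + tc q).+1
  | _ => 1
  end.

Definition wpm (c : cmd) (T : nat) (Q : mem -> Prop) (m : mem) : Prop :=
  exists m' t, [/\ ev c m t m', (t <= T)%N & Q m'].

Lemma wpm_do i m m' (Q : mem -> Prop) : exec W i m = [:: m'] -> Q m' ->
  wpm (Do i) 1 Q m.
Proof. by move=> e q; exists m', 1%N; split=> //; exact: ev_do. Qed.

Lemma wpm_seq c1 c2 T1 T2 Q m :
  wpm c1 T1 (wpm c2 T2 Q) m -> wpm (Seq c1 c2) (T1 + T2).+1 Q m.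
Proof.
move=> [m1 [t1 [e1 l1 [m2 [t2 [e2 l2 q]]]]]].
by exists m2, (t1 + t2).+1; split=> //; [exact: ev_seq e1 e2 | lia].
Qed.

Lemma wpm_conseq c T T' (Q Q' : mem -> Prop) m : (T <= T')%N ->
  (forall m', Q m' -> Q' m') -> wpm c T Q m -> wpm c T' Q' m.
Proof.
move=> le imp [m' [t [e l q]]]; exists m', t; split=> //; last exact: imp.
exact: leq_trans le.
Qed.

Lemma wpm_loop b p B (I : nat -> mem -> Prop) (Q : mem -> Prop) k m :
  (forall k m, I k m -> ~~ eval_test b m -> Q m) ->
  (forall k m, I k m -> eval_test b m ->
     exists2 k', (k' < k)%N & wpm p ((k - k') * B) (I k') m) ->
  I k m -> wpm (While b p) (k * B.+1).+1 Q m.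
Proof.
move=> Hend Hstep; have [N le] := ubnP k.
elim: N k le m => // N IH k le m Ik.
case eb: (eval_test b m).
  have [k' lt [m1 [t1 [e1 l1 I1]]]] := Hstep _ _ Ik eb.
  have [|m2 [t2 [e2 l2 q]]] := IH k' _ _ I1; first by lia.
  exists m2, (t1 + t2).+1; split=> //; first exact: ev_while e1 e2.
  have -> : k = (k' + (k - k').-1.+1)%N by lia.
  have e0 : ((k - k') = (k - k').-1.+1)%N by lia.
  rewrite e0 in l1.
  by move: (k - k').-1 l1 => d l1; nia.
exists m, 1%N; split=> //; first by apply: ev_while_end; rewrite eb.
by apply: Hend Ik _; rewrite eb.
Qed.

Definition wp (c : cmd) (T : nat) (Q : hst -> Prop) (h : hst) : Prop :=
  forall m, abs m = h -> wpm c T (fun m' => Q (abs m')) m.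

Definition wpb c := wp c (tc c).

Definition htest (b : test) (h : hst) : bool :=
  match b with
  | ILe x y => (wv h x <= wv h y)%N
  | RLe x y => rv h x <= rv h y
  end.

Definition wft (b : test) : bool :=
  match b with ILe x y => (x < 32) && (y < 32) | RLe x y => (x < 32) && (y < 32) end%N.

Lemma htestE b m : wft b -> htest b (abs m) = eval_test b m.
Proof. by case: b => x y /andP[/= -> ->]. Qed.

Lemma wp_conseq c T T' (Q Q' : hst -> Prop) h : (T <= T')%N ->
  (forall h', Q h' -> Q' h') -> wp c T Q h -> wp c T' Q' h.
Proof.
move=> le imp H m /H [m' [t [e l q]]]; exists m', t; split=> //.
  exact: leq_trans le.
exact: imp.
Qed.

Lemma wp_seq c1 c2 T1 T2 Q h :
  wp c1 T1 (wp c2 T2 Q) h -> wp (Seq c1 c2) (T1 + T2).+1 Q h.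
Proof.
move=> H m /H [m1 [t1 [e1 l1 H2]]]; have [m2 [t2 [e2 l2 q]]] := H2 _ erefl.
by exists m2, (t1 + t2).+1; split=> //; [exact: ev_seq e1 e2 | lia].
Qed.

Lemma wpb_seq c1 c2 Q h :
  wpb c1 (wpb c2 Q) h -> wpb (Seq c1 c2) Q h.
Proof. exact: wp_seq. Qed.

Lemma wpb_skip (Q : hst -> Prop) h : Q h -> wpb Skip Q h.
Proof. by move=> q m e; exists m, 1%N; rewrite e; split=> //; exact: ev_skip. Qed.

Lemma wpb_if b p q Q h : wft b ->
  (htest b h -> wpb p Q h) -> (~~ htest b h -> wpb q Q h) ->
  wpb (If b p q) Q h.
Proof.
move=> wb Hp Hq m e.
have : wp (if eval_test b m then p else q) (tc p + tc q) Q h.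
  rewrite -htestE // e; case: ifP => [/Hp|/negbT/Hq]; apply: wp_conseq => //;
  lia.
case/(_ _ e) => m' [t [e' l q']]; exists m', t.+1; split => //.
exact: ev_if.
Qed.

Lemma wp_loop b p B (I : nat -> hst -> Prop) (Q : hst -> Prop) k h : wft b ->
  (forall k h, I k h -> ~~ htest b h -> Q h) ->
  (forall k h, I k h -> htest b h ->
     exists2 k', (k' < k)%N & wp p ((k - k') * B) (I k') h) ->
  I k h -> wp (While b p) (k * B.+1).+1 Q h.
Proof.
move=> wb Hend Hstep Ik m em.
apply: (@wpm_loop _ _ _ (fun k m => I k (abs m)) _ k).
- by move=> k' m' Ik'; rewrite -htestE //; exact: Hend Ik'.
- move=> k' m' Ik'; rewrite -htestE // => /(Hstep _ _ Ik')[k'' lt H].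
  by exists k'' => //; exact: H.
- by rewrite em.
Qed.

Lemma wpb_wconst x k (Q : hst -> Prop) h : (x < 32)%N -> (k < W)%N ->
  Q (setwv h x k) -> wpb (Do (IConst x k)) Q h.
Proof.
move=> x32 kW q m e; exists (setw m x k), 1%N; split=> //.
  by apply: ev_do => /=; rewrite kW.
by rewrite abs_setwv // e.
Qed.

Lemma wpb_warith o x y z (Q : hst -> Prop) h : (x < 32)%N -> (y < 32)%N ->
  (z < 32)%N -> (eval_iop o (wv h y) (wv h z) < W)%N ->
  Q (setwv h x (eval_iop o (wv h y) (wv h z))) ->
  wpb (Do (IArith o x y z)) Q h.
Proof.
move=> x32 y32 z32 kW q m e.
exists (setw m x (eval_iop o (wv h y) (wv h z))), 1%N; split=> //.
  by apply: ev_do => /=; move: kW; rewrite -e /= y32 z32 => ->.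
by rewrite abs_setwv // e.
Qed.

(* The address of entry w[x] of array c, left in the scratch word 32. *)
Definition addr (c x : nat) : cmd :=
  Seq (Do (IConst 33 8)) (Seq (Do (IArith IMul 32 33 x))
    (Seq (Do (IConst 33 (64 + c))) (Do (IArith IAdd 32 33 32)))).

Lemma ev_addr c x m : (x < 32)%N ->  (64 + c < W)%N ->
  (cell c (word m x) < W)%N ->
  exists m' t, [/\ ev (addr c x) m t m', (t <= tc (addr c x))%N,
    abs m' = abs m, real m' = real m & word m' 32 = cell c (word m x)].
Proof.
rewrite /cell => x32 cW aW; have W8 : (8 < W)%N by lia.
have mW : (8 * word m x < W)%N by lia.
eexists; exists 7%N; split.
- apply: (ev_seq (t1 := 1) (t2 := 5)).
    by apply: ev_do; rewrite /= W8.
  apply: (ev_seq (t1 := 1) (t2 := 3)).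
    by apply: ev_do; rewrite /= /upd /= (_ : x == 33 = false) ?mW //; lia.
  apply: (ev_seq (t1 := 1) (t2 := 1)).
    by apply: ev_do; rewrite /= cW.
  by apply: ev_do; rewrite /= /upd /= aW.
- by [].
- by rewrite !abs_scratchw.
- by [].
- by rewrite /= /upd.
Qed.

Definition wload x c y := Seq (addr c y) (Do (ILoad x 32)).
Definition wstore c x y := Seq (addr c x) (Do (IStore 32 y)).

Lemma wpb_wload x c y (Q : hst -> Prop) h : (x < 32)%N -> (y < 32)%N ->
  (c < 8)%N -> (cell c (wv h y) < W)%N ->
  Q (setwv h x (wa h c (wv h y))) -> wpb (wload x c y) Q h.
Proof.
move=> x32 y32 c8 aW q m e; move: aW; rewrite -e /= y32 => aW.
have cW : (64 + c < W)%N by rewrite /cell in aW; lia.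
have [m1 [t1 [e1 l1 a1 r1 d1]]] := ev_addr y32 cW aW.
exists (setw m1 x (word m1 (word m1 32))), (t1 + 1).+1; split.
- by apply: ev_seq e1 _; exact: ev_do.
- by move: l1; rewrite /wload /=; lia.
- rewrite abs_setwv // a1 e d1; congr Q: q; congr setwv.
  have : wa (abs m1) c (word m y) = wa (abs m) c (word m y) by rewrite a1.
  by rewrite -e /= c8 y32 => ->.
Qed.

Lemma wpb_wstore c x y (Q : hst -> Prop) h : (x < 32)%N -> (y < 32)%N ->
  (c < 8)%N -> (cell c (wv h x) < W)%N ->
  Q (setwa h c (wv h x) (wv h y)) -> wpb (wstore c x y) Q h.
Proof.
move=> x32 y32 c8 aW q m e; move: aW; rewrite -e /= x32 => aW.
have cW : (64 + c < W)%N by rewrite /cell in aW; lia.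
have [m1 [t1 [e1 l1 a1 r1 d1]]] := ev_addr x32 cW aW.
exists (setw m1 (word m1 32) (word m1 y)), (t1 + 1).+1; split.
- by apply: ev_seq e1 _; exact: ev_do.
- by move: l1; rewrite /wstore /=; lia.
- rewrite d1 abs_setwa // a1 e; congr Q: q; congr setwa.
    by rewrite -e /= x32.
  have : wv (abs m1) y = wv (abs m) y by rewrite a1.
  by rewrite -e /= y32 => ->.
Qed.

Inductive rexpr :=
  | RV of nat
  | RC of nat
  | RA of nat & nat
  | RO of rop & rexpr & rexpr.

Fixpoint reval (e : rexpr) (h : hst) : R :=
  match e with
  | RV x => rv h x
  | RC k => k%:R
  | RA c x => ra h c (wv h x)
  | RO o e1 e2 => eval_rop o (reval e1 h) (reval e2 h)
  end.

Fixpoint rdepth (e : rexpr) : nat :=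
  match e with
  | RO _ e1 e2 => maxn (rdepth e1) (rdepth e2).+1
  | _ => 1
  end.

Fixpoint rwf (e : rexpr) : bool :=
  match e with
  | RV x => (x < 32)%N
  | RC k => true
  | RA c x => (c < 8)%N && (x < 32)%N
  | RO o e1 e2 => rwf e1 && rwf e2
  end.

Fixpoint rsafe (e : rexpr) (h : hst) : Prop :=
  match e with
  | RV x => 33 < W
  | RC k => k < W
  | RA c x => cell c (wv h x) < W
  | RO o e1 e2 => rsafe e1 h /\ rsafe e2 h
  end%N.

Fixpoint rcomp (e : rexpr) (d : nat) : cmd :=
  match e with
  | RV x => Seq (Do (IConst 32 x)) (Do (RLoad d 32))
  | RC k => Seq (Do (IConst 32 k)) (Do (RofI d 32))
  | RA c x => Seq (addr c x) (Do (RLoad d 32))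
  | RO o e1 e2 => Seq (rcomp e1 d) (Seq (rcomp e2 d.+1)
                    (Do (RArith o d d d.+1)))
  end.

Lemma ev_rcomp e d m : (32 <= d)%N -> (d + rdepth e <= 64)%N ->
  rwf e -> rsafe e (abs m) ->
  exists m' t, [/\ ev (rcomp e d) m t m', (t <= tc (rcomp e d))%N,
    abs m' = abs m, real m' d = reval e (abs m) &
    forall d', (d' < d)%N -> real m' d' = real m d'].
Proof.
elim: e d m => [x|k|c x|o e1 IH1 e2 IH2] d m d32 dd wf sf; rewrite /= in dd wf sf.
- rewrite /= in wf sf; eexists; exists 3%N; split.
  + apply: (ev_seq (t1 := 1) (t2 := 1)); last exact: ev_do.
    by apply: ev_do; rewrite /= (_ : x < W)%N //; lia.
  + by [].
  + by rewrite abs_scratchr ?abs_scratchw // /scratch; lia.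
  + by rewrite /= /upd eqxx /= wf.
  + by move=> d' lt; rewrite /= /upd (_ : d' == d = false) //; lia.
- eexists; exists 3%N; split.
  + apply: (ev_seq (t1 := 1) (t2 := 1)); last exact: ev_do.
    by apply: ev_do; rewrite /= sf.
  + by [].
  + by rewrite abs_scratchr ?abs_scratchw // /scratch; lia.
  + by rewrite /= /upd eqxx.
  + by move=> d' lt; rewrite /= /upd (_ : d' == d = false) //; lia.
- case/andP: wf => c8 x32; rewrite x32 in sf.
  have cW : (64 + c < W)%N by rewrite /cell in sf; lia.
  have [m1 [t1 [e1 l1 a1 r1 d1]]] := ev_addr x32 cW sf.
  exists (setr m1 d (real m1 (word m1 32))), (t1 + 1).+1; split.
  + by apply: ev_seq e1 _; exact: ev_do.
  + by move: l1; rewrite /=; lia.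
  + by rewrite abs_scratchr // /scratch; lia.
  + by rewrite /= /upd eqxx d1 r1 c8 x32.
  + by move=> d' lt; rewrite /= /upd (_ : d' == d = false) ?r1 //; lia.
- case/andP: wf => wf1 wf2; case: sf => sf1 sf2.
  have [| |m1 [t1 [ev1 l1 a1 v1 f1]]] := IH1 d m _ _ wf1 sf1; [by lia..|].
  have [| | |m2 [t2 [ev2 l2 a2 v2 f2]]] := IH2 d.+1 m1 _ _ wf2;
    [by lia..|by rewrite a1|].
  exists (setr m2 d (eval_rop o (real m2 d) (real m2 d.+1))), (t1 + (t2 + 1).+1).+1.
  split.
  + by apply: ev_seq ev1 _; apply: ev_seq ev2 _; exact: ev_do.
  + by move: l1 l2 => /=; lia.
  + by rewrite abs_scratchr ?a2 // /scratch; lia.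
  + by rewrite /= /upd eqxx f2 // v1 v2 a1.
  + move=> d' lt; rewrite /= /upd (_ : d' == d = false) ?f2 ?f1 //; lia.
Qed.

Definition rset x e := Seq (rcomp e 32)
  (Seq (Do (IConst 32 32)) (Do (RLoad x 32))).
Definition rstore c x e := Seq (rcomp e 32)
  (Seq (addr c x) (Do (RStore 32 32))).

Lemma wpb_rset x e (Q : hst -> Prop) h : (x < 32)%N -> (rdepth e <= 32)%N ->
  rwf e -> (32 < W)%N -> rsafe e h ->
  Q (setrv h x (reval e h)) -> wpb (rset x e) Q h.
Proof.
move=> x32 dp wf W32 sf q m em; rewrite -em in sf q.
have [||m1 [t1 [e1 l1 a1 v1 _]]] := @ev_rcomp e 32 m _ _ wf sf => //.
exists (setr (setw m1 32 32) x (real m1 32)), (t1 + 3).+1; split.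
- apply: ev_seq e1 _; apply: (ev_seq (t1 := 1) (t2 := 1)).
    by apply: ev_do; rewrite /= W32.
  exact: ev_do.
- by move: l1; rewrite /rset /=; lia.
- by rewrite abs_setrv // abs_scratchw // a1 v1.
Qed.

Lemma wpb_rstore c x e (Q : hst -> Prop) h : (c < 8)%N -> (x < 32)%N ->
  (rdepth e <= 32)%N -> rwf e -> (cell c (wv h x) < W)%N -> rsafe e h ->
  Q (setra h c (wv h x) (reval e h)) -> wpb (rstore c x e) Q h.
Proof.
move=> c8 x32 dp wf aW sf q m em; rewrite -em in sf q aW.
have [||m1 [t1 [e1 l1 a1 v1 _]]] := @ev_rcomp e 32 m _ _ wf sf => //.
rewrite -a1 /= x32 in aW.
have cW : (64 + c < W)%N by rewrite /cell in aW; lia.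
have [m2 [t2 [e2 l2 a2 r2 d2]]] := ev_addr x32 cW aW.
exists (setr m2 (word m2 32) (real m2 32)), (t1 + (t2 + 1).+1).+1; split.
- by apply: ev_seq e1 _; apply: ev_seq e2 _; exact: ev_do.
- by move: l1 l2; rewrite /rstore /=; lia.
- rewrite d2 abs_setra // r2 v1 a2 a1; congr Q: q; congr setra.
  by rewrite -a1 /= x32.
Qed.

End Machine.
Arguments tc : simpl never.

(** * Distances to lines, and theta graphs *)

Section Euclid.
Variable R : realType.
Implicit Types (u v w p q x y z : 'rV[R]_3) (t : R).

Definition dot u v : R := \sum_(i < 3) u 0 i * v 0 i.

Lemma dotC u v : dot u v = dot v u.
Proof. by apply: eq_bigr => i _; rewrite mulrC. Qed.

Lemma dotDr u v w : dot u (v + w) = dot u v + dot u w.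
Proof. by rewrite -big_split; apply: eq_bigr => i _; rewrite mxE mulrDr. Qed.

Lemma dotZr (a : R) u v : dot u (a *: v) = a * dot u v.
Proof. by rewrite /dot mulr_sumr; apply: eq_bigr => i _; rewrite mxE mulrCA. Qed.

Lemma dotNr u v : dot u (- v) = - dot u v.
Proof. by rewrite -scaleN1r dotZr mulN1r. Qed.

Lemma dotBr u v w : dot u (v - w) = dot u v - dot u w.
Proof. by rewrite dotDr dotNr. Qed.

Lemma dotDl u v w : dot (v + w) u = dot v u + dot w u.
Proof. by rewrite dotC dotDr !(dotC u). Qed.

Lemma dotZl (a : R) u v : dot (a *: v) u = a * dot v u.
Proof. by rewrite dotC dotZr (dotC u). Qed.

Lemma dotBl u v w : dot (v - w) u = dot v u - dot w u.
Proof. by rewrite dotC dotBr !(dotC u). Qed.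

Lemma dot0r u : dot u 0 = 0.
Proof. by rewrite -(scale0r 0) dotZr mul0r. Qed.

Lemma dot_ge0 u : 0 <= dot u u.
Proof. by apply: sumr_ge0 => i _; rewrite -expr2 sqr_ge0. Qed.

Lemma dot_eq0 u : (dot u u == 0) = (u == 0).
Proof.
apply/idP/eqP => [|->]; last by rewrite dot0r.
rewrite psumr_eq0 => [/allP H|i _]; last by rewrite -expr2 sqr_ge0.
apply/rowP => i; rewrite mxE; apply/eqP.
by have := H i (mem_index_enum i); rewrite /= mulf_eq0 orbb.
Qed.

Lemma dot_gt0 u : (0 < dot u u) = (u != 0).
Proof. by rewrite lt_def dot_ge0 andbT dot_eq0. Qed.

Lemma sqr_le_dot u i : u 0 i ^+ 2 <= dot u u.
Proof.
by rewrite /dot (bigD1 i) //= expr2 lerDl; apply: sumr_ge0 => j _;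
  rewrite -expr2 sqr_ge0.
Qed.

Lemma CauchySchwarz_dot u v : dot u v ^+ 2 <= dot u u * dot v v.
Proof.
have [->|v0] := eqVneq v 0; first by rewrite !dot0r expr0n mulr0.
have v1 : 0 < dot v v by rewrite dot_gt0.
have := dot_ge0 (dot v v *: u - dot u v *: v).
rewrite !(dotBl, dotBr, dotZl, dotZr) (dotC v u) => H.
rewrite -subr_ge0 -(pmulr_rge0 _ v1); apply: le_trans H _.
by rewrite le_eqVlt; apply/orP; left; apply/eqP; ring.
Qed.

Lemma enormE u : enorm u = Num.sqrt (dot u u).
Proof. by congr Num.sqrt; apply: eq_bigr => i _; rewrite expr2. Qed.

Lemma enorm_ge0 u : 0 <= enorm u.
Proof. exact: sqrtr_ge0. Qed.

Lemma sqr_enorm u : enorm u ^+ 2 = dot u u.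
Proof. by rewrite enormE sqr_sqrtr // dot_ge0. Qed.

Lemma enorm_le u (a : R) : 0 <= a -> (enorm u <= a) = (dot u u <= a ^+ 2).
Proof. by move=> a0; rewrite -sqr_enorm ler_sqr ?nnegrE ?enorm_ge0. Qed.

Lemma enorm_eq0 u : (enorm u == 0) = (u == 0).
Proof. by rewrite -dot_eq0 -sqr_enorm sqrf_eq0. Qed.

Lemma enorm_gt0 u : (0 < enorm u) = (u != 0).
Proof. by rewrite lt_def enorm_ge0 andbT enorm_eq0. Qed.

Lemma dot_le_enorm u v : `|dot u v| <= enorm u * enorm v.
Proof.
rewrite -ler_sqr ?nnegrE ?mulr_ge0 ?enorm_ge0 // exprMn !sqr_enorm.
by rewrite real_normK ?num_real // CauchySchwarz_dot.
Qed.

Lemma enormD u v : enorm (u + v) <= enorm u + enorm v.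
Proof.
rewrite enorm_le ?addr_ge0 ?enorm_ge0 // sqrrD !sqr_enorm dotDl !dotDr.
have := le_trans (ler_norm _) (dot_le_enorm u v); rewrite (dotC v u); lra.
Qed.

Lemma enormZ (a : R) u : enorm (a *: u) = `|a| * enorm u.
Proof. by rewrite !enormE dotZl dotZr mulrA -expr2 sqrtrM ?sqr_ge0 // sqrtr_sqr. Qed.

Lemma enormN u : enorm (- u) = enorm u.
Proof. by rewrite -scaleN1r enormZ normrN1 mul1r. Qed.

Lemma enormB u v : enorm (u - v) = enorm (v - u).
Proof. by rewrite -opprB enormN. Qed.

(* Squared distance from 0 to the line through p and q. *)
Definition sqr_line_dist p q : R :=
  let w := q - p in (dot p p * dot w w - dot p w ^+ 2) / dot w w.

Definition line_dist p q : R := Num.sqrt (sqr_line_dist p q).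

Lemma line_dist_ge0 p q : 0 <= line_dist p q.
Proof. exact: sqrtr_ge0. Qed.

Lemma line_dist_le p q t : p != q ->
  line_dist p q <= enorm (p + t *: (q - p)).
Proof.
rewrite eq_sym -subr_eq0 => w0; rewrite /line_dist enormE ler_wsqrtr //.
rewrite /sqr_line_dist; move: (q - p) w0 => /= w w0.
have w1 : 0 < dot w w by rewrite dot_gt0.
rewrite ler_pdivrMr // -subr_ge0 !(dotDl, dotDr, dotZl, dotZr) (dotC w p).
rewrite [X in 0 <= X](_ : _ = (dot p w + t * dot w w) ^+ 2) ?sqr_ge0 //.
by ring.
Qed.

Lemma line_dist_foot p q : p != q -> exists t,
  let x := p + t *: (q - p) in dot x (q - p) = 0 /\ enorm x = line_dist p q.
Proof.
rewrite eq_sym -subr_eq0 => w0; exists (- dot p (q - p) / dot (q - p) (q - p)).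
rewrite /line_dist /sqr_line_dist; move: (q - p) w0 => /= w w0.
have w1 : dot w w != 0 by rewrite dot_eq0.
split=> /=; first by rewrite dotDl dotZl; field.
rewrite enormE; congr Num.sqrt.
by rewrite !(dotDl, dotDr, dotZl, dotZr) (dotC w p); field.
Qed.

Lemma line_dist_leP p q : p != q -> line_dist p q <= enorm p.
Proof. by move=> /(@line_dist_le _ _ 0); rewrite scale0r addr0. Qed.

Lemma dist_lineE y p q : p != q -> dist_line y p q = line_dist (p - y) (q - y).
Proof.
move=> pq; have pq' : p - y != q - y by rewrite (inj_eq (addIr _)).
have E t : enorm (y - (p + t *: (q - p))) =
    enorm (p - y + t *: ((q - y) - (p - y))).
  rewrite -enormN; congr enorm; rewrite opprB.
  have -> : q - y - (p - y) = q - p by rewrite opprB addrA subrK.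
  by rewrite addrAC.
apply/eqP; rewrite eq_le; apply/andP; split.
  have [t [_ <-]] := line_dist_foot pq'.
  apply: ge_inf; first by exists 0 => _ [x _ <-]; exact: enorm_ge0.
  by exists (p + t *: (q - p)); [exists t | rewrite E].
apply: lb_le_inf; first by exists (enorm (y - p)); exists p => //; exists 0;
  rewrite scale0r addr0.
by move=> _ [_ [t ->] <-]; rewrite E; exact: line_dist_le.
Qed.

(* The two points, scaled to the plane [dot u x = 1]: the slope between them is
   the point where the line meets the plane [dot u x = 0]. *)
Lemma line_dist_slope u p q : dot u p != 0 -> dot u q != 0 -> p != q ->
  line_dist p q * `|(dot u q)^-1 - (dot u p)^-1| <=
    enorm ((dot u q)^-1 *: q - (dot u p)^-1 *: p).
Proof.
set a := dot u p; set b := dot u q => a0 b0 pq.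
have [->|ab] := eqVneq a b; first by rewrite subrr normr0 mulr0 enorm_ge0.
have ab' : a - b != 0 by rewrite subr_eq0.
have -> : b^-1 *: q - a^-1 *: p =
    (b^-1 - a^-1) *: (p + (a / (a - b)) *: (q - p)).
  apply/rowP => i; rewrite !mxE; field.
  by rewrite a0 b0 ab'.
by rewrite enormZ mulrC ler_wpM2l // line_dist_le.
Qed.

Lemma slope_foot u p q t : dot u p != 0 -> dot u q != 0 ->
  dot u p != dot u q -> dot u (p + t *: (q - p)) = 0 ->
  enorm ((dot u q)^-1 *: q - (dot u p)^-1 *: p) =
    enorm (p + t *: (q - p)) * `|(dot u q)^-1 - (dot u p)^-1|.
Proof.
set a := dot u p; set b := dot u q => a0 b0 ab.
have ab' : a - b != 0 by rewrite subr_eq0.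
have ba' : b - a != 0 by rewrite subr_eq0 eq_sym.
rewrite dotDr dotZr dotBr -/a -/b => H.
have -> : t = a / (a - b).
  apply: (mulIf ab'); rewrite divfK //; move: H; lra.
rewrite mulrC -enormZ; congr enorm.
by apply/rowP => i; rewrite !mxE; field; rewrite a0 b0 ab'.
Qed.

(* A finite set of points of an affine plane, with a real label rho.  Slopes
   along the edges of a theta graph bound all slopes, up to the stretch of
   the graph. *)
Lemma theta_graph_slope (T : finType) (V : pred T) (X : T -> 'rV[R]_3)
    (rho : T -> R) (u : 'rV[R]_3) (cone : 'rV[R]_3 -> 'rV[R]_3 -> Prop)
    (eta delta : R) :
  0 <= eta < 1 -> 0 <= delta ->
  (forall a, V a -> dot u (X a) = 1) ->
  (forall g1 g2 y z, cone g1 g2 -> dot u y = 0 -> dot u z = 0 ->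
     0 <= dot g1 y -> 0 <= dot g2 y -> 0 <= dot g1 z -> 0 <= dot g2 z ->
     enorm (dot (g1 + g2) z *: y - dot (g1 + g2) y *: z) <=
       eta * dot (g1 + g2) y * enorm z) ->
  (forall z, dot u z = 0 -> z != 0 -> exists g1 g2, cone g1 g2 /\
     (0 < dot g1 z /\ 0 < dot g2 z \/ dot g1 z < 0 /\ dot g2 z < 0)) ->
  (forall a b, V a -> V b -> X a = X b -> rho a = rho b) ->
  (forall a b g1 g2, V a -> V b -> cone g1 g2 ->
     dot g1 (X a) < dot g1 (X b) -> dot g2 (X a) < dot g2 (X b) ->
     exists c, [/\ V c, X c != X a,
       dot g1 (X a) <= dot g1 (X c) /\ dot g2 (X a) <= dot g2 (X c),
       dot (g1 + g2) (X c) <= dot (g1 + g2) (X b) &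
       delta * `|rho c - rho a| <= enorm (X c - X a)]) ->
  forall a b, V a -> V b -> delta * `|rho b - rho a| <=
    (1 + eta) / (1 - eta) * enorm (X b - X a).
Proof.
move=> /andP[eta0 eta1] delta0 uX narrow cover injX edge a b Va Vb.
have eta1' : 0 < 1 - eta by rewrite subr_gt0.
have tau0 : 0 < (1 + eta) / (1 - eta) by rewrite divr_gt0 // (lt_le_trans ltr01) // lerDl.
have tauE : 1 + eta = (1 + eta) / (1 - eta) * (1 - eta) by rewrite divfK ?gt_eqF.
rewrite leNgt; apply/negP; move: tau0 tauE.
set tau := (1 + eta) / (1 - eta) => tau0 tauE bad.
pose P := fun ab : T * T => [&& V ab.1, V ab.2 &
  tau * enorm (X ab.2 - X ab.1) < delta * `|rho ab.2 - rho ab.1|].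
have Pab : P (a, b) by apply/and3P.
case: (arg_minP (fun ab : T * T => enorm (X ab.2 - X ab.1)) Pab).
move=> [{Pab}a' b'] Pab min; move: (Pab) => /and3P[/= {Va}Va {Vb}Vb {}bad].
move: Pab min => /=; move: a' b' Va Vb bad => {}a {}b.
wlog : a b / exists g1 g2, cone g1 g2 /\
    (dot g1 (X a) < dot g1 (X b) /\ dot g2 (X a) < dot g2 (X b)).
  move=> W Va Vb bad Pab min.
  have [e|ne] := eqVneq (X b) (X a).
    by move: bad; rewrite (injX _ _ Vb Va e) subrr normr0 mulr0 ltNge
      mulr_ge0 ?enorm_ge0 // ltW.
  have [||g1 [g2 [cg [[h1 h2]|[h1 h2]]]]] := cover (X b - X a).
  - by rewrite dotBr !uX // subrr.
  - by rewrite subr_eq0.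
  - apply: (W a b) => //; exists g1, g2; split => //.
    by move: h1 h2; rewrite !dotBr !subr_gt0.
  - apply: (W b a) => //.
    + exists g1, g2; split => //.
      by move: h1 h2; rewrite !dotBr !subr_lt0.
    + by rewrite enormB distrC.
    + by apply/and3P; split => //=; rewrite enormB distrC.
    + by move=> j /min; rewrite enormB.
move=> [g1 [g2 [cg [h1 h2]]]] Va Vb bad Pab min.
have [c [Vc ca [k1 k2] ks ke]] := edge a b g1 g2 Va Vb cg h1 h2.
set z := X b - X a in bad min; set y := X c - X a in ke.
have uz : dot u z = 0 by rewrite dotBr !uX // subrr.
have uy : dot u y = 0 by rewrite dotBr !uX // subrr.
have y0 : 0 < enorm y by rewrite enorm_gt0 subr_eq0.
have z1 : 0 < dot g1 z by rewrite dotBr subr_gt0.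
have z2 : 0 < dot g2 z by rewrite dotBr subr_gt0.
have y1 : 0 <= dot g1 y by rewrite dotBr subr_ge0.
have y2 : 0 <= dot g2 y by rewrite dotBr subr_ge0.
have sz : 0 < dot (g1 + g2) z by rewrite dotDl addr_gt0.
have sy : 0 <= dot (g1 + g2) y by rewrite dotDl addr_ge0.
have syz : dot (g1 + g2) y <= dot (g1 + g2) z by rewrite !dotBr lerB.
have nar := narrow _ _ y z cg uy uz y1 y2 (ltW z1) (ltW z2).
set S := dot (g1 + g2) z in sz syz nar; set s := dot (g1 + g2) y in sy syz nar.
pose r := s / S; have rS : s = r * S by rewrite divfK ?gt_eqF.
have r0 : 0 <= r by rewrite divr_ge0 // ltW.
have r1 : r <= 1 by rewrite ler_pdivrMr // mul1r.
pose e := y - r *: z; have nz : 0 <= enorm z := enorm_ge0 z.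
have e1 : enorm e <= eta * r * enorm z.
  rewrite -(ler_pM2l sz) -{1}(gtr0_norm sz) -enormZ scalerBr scalerA.
  by rewrite (mulrC S r) -rS; apply: le_trans nar _; rewrite rS;
    rewrite le_eqVlt; apply/orP; left; apply/eqP; ring.
have l1 : enorm y <= (1 + eta) * r * enorm z.
  have -> : y = r *: z + e by rewrite addrC subrK.
  apply: le_trans (enormD _ _) _; rewrite enormZ ger0_norm //; lra.
have l2 : enorm (z - y) <= (1 - r) * enorm z + eta * r * enorm z.
  have -> : z - y = (1 - r) *: z - e.
    have aux (p q : 'rV[R]_3) : p - q = (1 - r) *: p - (q - r *: p).
      by rewrite scalerBl scale1r opprB addrA subrK.
    exact: aux.
  apply: le_trans (enormD _ _) _; rewrite enormN enormZ ger0_norm ?subr_ge0 //.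
  by rewrite lerD2l.
have zy : z - y = X b - X c by rewrite opprB addrA subrK.
have rz : 0 < r * enorm z.
  rewrite lt_def mulr_ge0 // andbT; apply/eqP => q0.
  by move: l1; rewrite -mulrA q0 mulr0; lra.
have l3 : tau * enorm (z - y) <= tau * enorm z - enorm y.
  have -> : tau * enorm z - enorm y = tau * (enorm z - (enorm y) / tau).
    by rewrite mulrBr [X in _ = _ - X]mulrC divfK // gt_eqF.
  apply: ler_wpM2l; first exact: ltW.
  apply: le_trans l2 _; suff : enorm y / tau <= (1 - eta) * (r * enorm z) by lra.
  rewrite ler_pdivrMr //; apply: le_trans l1 _.
  by rewrite tauE le_eqVlt; apply/orP; left; apply/eqP; ring.
have : ~~ P (c, b).
  apply/negP => Pcb; have /= := min _ Pcb; rewrite -zy => h.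
  have : eta * (r * enorm z) < 1 * (r * enorm z) by rewrite ltr_pM2r.
  by move: h l2; lra.
rewrite /P /= Vc Vb /= -leNgt -zy => h.
have tri : `|rho b - rho a| <= `|rho c - rho a| + `|rho b - rho c|.
  by rewrite [leRHS]addrC ler_distD.
have := ler_wpM2l delta0 tri; rewrite mulrDr; move: bad ke h l3; lra.
Qed.

End Euclid.

(** * Cones and the net of normal vectors *)

Definition distinct3 (v s t : 'I_3) : bool := [&& v != s, v != t & s != t].

Lemma mem_distinct3 (v s t i : 'I_3) : distinct3 v s t -> i \in [:: v; s; t].
Proof.
move=> /and3P[vs vt st]; apply/negPn/negP => h.
have := max_card (mem [:: i; v; s; t]); rewrite card_ord (card_uniqP _) //=.
by rewrite h !inE (negbTE vs) (negbTE vt) (negbTE st).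
Qed.

Lemma sum_distinct3 (R : realType) (v s t : 'I_3) (F : 'I_3 -> R) :
  distinct3 v s t -> \sum_(i < 3) F i = F v + F s + F t.
Proof.
move=> d; have /and3P[vs vt st] := d; rewrite (bigD1 v) //= (bigD1 s) 1?eq_sym //=.
rewrite (bigD1 t) /=; last by rewrite !(eq_sym t) vt.
rewrite big_pred0 ?addr0 ?addrA // => i; apply/negbTE.
by have := mem_distinct3 i d; rewrite !inE -!negb_or negbK orbA.
Qed.

Lemma exists_distinct3_max (R : realType) (w : 'I_3 -> R) :
  exists v s t, [/\ distinct3 v s t, w s <= w v & w t <= w v].
Proof.
pose v := [arg max_(i > (ord0 : 'I_3)) w i]%O.
have max j : w j <= w v by rewrite /v; case: arg_maxP => // i _; apply.
suff [s [t d]] : exists s t, distinct3 v s t by exists v, s, t.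
case: {max} v => -[|[|[|//]]] lt; [exists (inord 1), (inord 2)|
  exists (inord 0), (inord 2)|exists (inord 0), (inord 1)];
  by rewrite /distinct3 -!val_eqE /= !inordK.
Qed.

(* Integer vectors are given by pairs of naturals, (a, b) standing for a - b. *)
Definition coefs := 'I_3 -> nat * nat.

Definition cvec (R : realType) (g : coefs) : 'rV[R]_3 :=
  \row_i ((g i).1%:R - (g i).2%:R).

Definition param := ('I_3 * 'I_3 * 'I_3 * (nat * nat * nat))%type.

(* For x = ((v, s, t), (j1, j2, j)), the normal is N e_v + (j1 - N) e_s +
   (j2 - N) e_t, and the cone is the set of the z such that z_t / z_s lies
   between (j - N - 1) / N and (j - N + 1) / N, with z_s >= 0. *)
Definition normal_coefs (N : nat) (x : param) : coefs :=
  let: (v, s, t, (j1, j2, j)) := x in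
  fun i => if i == v then (N, 0) else if i == s then (j1, N) else (j2, N).

Definition lower_coefs (N : nat) (x : param) : coefs :=
  let: (v, s, t, (j1, j2, j)) := x in
  fun i => if i == t then (N, 0) else if i == s then (N.+1, j) else (0, 0).

Definition upper_coefs (N : nat) (x : param) : coefs :=
  let: (v, s, t, (j1, j2, j)) := x in
  fun i => if i == t then (0, N) else if i == s then (j.+1, N) else (0, 0).

Definition params (N : nat) : seq param :=
  let r := iota 0 (2 * N).+1 in
  [seq (x, y) | x <- enum {: 'I_3 * 'I_3 * 'I_3},
                y <- [seq (z, j) | z <- [seq (j1, j2) | j1 <- r, j2 <- r],
                                   j <- r]].

Lemma mem_params N v s t j1 j2 j : (j1 <= 2 * N)%N -> (j2 <= 2 * N)%N ->
  (j <= 2 * N)%N -> (v, s, t, (j1, j2, j)) \in params N.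
Proof.
move=> h1 h2 h; apply: allpairs_f; first by rewrite mem_enum.
by apply: allpairs_f; [apply: allpairs_f|]; rewrite mem_iota.
Qed.

Lemma lit_params N x i : x \in params N ->
  [/\ ((normal_coefs N x i).1 <= 2 * N + 1)%N, ((normal_coefs N x i).2 <= 2 * N + 1)%N,
      ((lower_coefs N x i).1 <= 2 * N + 1)%N, ((lower_coefs N x i).2 <= 2 * N + 1)%N &
      ((upper_coefs N x i).1 <= 2 * N + 1)%N /\ ((upper_coefs N x i).2 <= 2 * N + 1)%N].
Proof.
case/allpairsPdep => -[[v s] t] [[[j1 j2] j] [_ + ->]].
case/allpairsPdep => z [j' [/allpairsPdep[a [b [ha hb ->]]] hj [-> -> ->]]].
move: ha hb hj; rewrite !mem_iota => ha hb hj.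
by split; rewrite /normal_coefs /lower_coefs /upper_coefs; repeat case: ifP => _ /=;
  lia.
Qed.

Section Cones.
Variable R : realType.
Variables (N : nat).
Hypothesis N_gt0 : (0 < N)%N.
Variables (v s t : 'I_3) (j1 j2 : nat).
Hypothesis vst : distinct3 v s t.
Hypotheses (hj1 : (j1 <= 2 * N)%N) (hj2 : (j2 <= 2 * N)%N).

Let prm j : param := (v, s, t, (j1, j2, j)).
Local Notation vec g := (cvec R g).

Let st : (s == t) = false. Proof. by case/and3P: vst => _ _ /negbTE. Qed.
Let vs : (v == s) = false. Proof. by case/and3P: vst => /negbTE. Qed.
Let vt : (v == t) = false. Proof. by case/and3P: vst => _ /negbTE. Qed.
Let Npos : 0 < (N%:R : R). Proof. by rewrite ltr0n. Qed.

Lemma dot_normal j (z : 'rV[R]_3) : dot (vec (normal_coefs N (prm j))) z =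
  N%:R * z 0 v + (j1%:R - N%:R) * z 0 s + (j2%:R - N%:R) * z 0 t.
Proof.
rewrite /dot (sum_distinct3 _ vst) !mxE /normal_coefs /=.
by rewrite eqxx ![_ == v]eq_sym vs vt eqxx [t == s]eq_sym st subr0.
Qed.

Lemma dot_lower j (z : 'rV[R]_3) : dot (vec (lower_coefs N (prm j))) z =
  N%:R * z 0 t - (j%:R - N%:R - 1) * z 0 s.
Proof.
rewrite /dot (sum_distinct3 _ vst) !mxE /lower_coefs /=.
rewrite eqxx ?[_ == v]eq_sym vs vt eqxx ?[t == s]eq_sym st /=.
by rewrite -natr1; ring.
Qed.

Lemma dot_upper j (z : 'rV[R]_3) : dot (vec (upper_coefs N (prm j))) z =
  (j%:R - N%:R + 1) * z 0 s - N%:R * z 0 t.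
Proof.
rewrite /dot (sum_distinct3 _ vst) !mxE /upper_coefs /=.
rewrite eqxx ?[_ == v]eq_sym vs vt eqxx ?[t == s]eq_sym st /=.
by rewrite -natr1; ring.
Qed.

Lemma dot_sum_coefs j (z : 'rV[R]_3) :
  dot (vec (lower_coefs N (prm j)) + vec (upper_coefs N (prm j))) z = 2 * z 0 s.
Proof. by rewrite dotDl dot_lower dot_upper; ring. Qed.

Lemma dot_self (z : 'rV[R]_3) : dot z z = z 0 v ^+ 2 + z 0 s ^+ 2 + z 0 t ^+ 2.
Proof. by rewrite /dot (sum_distinct3 _ vst) !expr2. Qed.

Let j1N : `|j1%:R - N%:R| <= N%:R :> R.
Proof.
have : (j1%:R : R) <= (2 * N)%:R by rewrite ler_nat.
have : 0 <= (j1%:R : R) by []; rewrite natrM ler_norml; lra.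
Qed.

Let j2N : `|j2%:R - N%:R| <= N%:R :> R.
Proof.
have : (j2%:R : R) <= (2 * N)%:R by rewrite ler_nat.
have : 0 <= (j2%:R : R) by []; rewrite natrM ler_norml; lra.
Qed.

Lemma normal_coordinate j (z : 'rV[R]_3) :
  dot (vec (normal_coefs N (prm j))) z = 0 -> `|z 0 v| <= `|z 0 s| + `|z 0 t|.
Proof.
rewrite dot_normal => H.
rewrite -(ler_pM2l Npos) -{1}(gtr0_norm Npos) -normrM mulrDr.
have -> : N%:R * z 0 v = - ((j1%:R - N%:R) * z 0 s + (j2%:R - N%:R) * z 0 t).
  by apply/eqP; rewrite -addr_eq0 addrA H.
rewrite normrN; apply: le_trans (ler_normD _ _) _; rewrite !normrM.
by apply: lerD; exact: ler_wpM2r.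
Qed.

Lemma cone_eq0 j (z : 'rV[R]_3) : dot (vec (normal_coefs N (prm j))) z = 0 ->
  dot (vec (lower_coefs N (prm j))) z = 0 ->
  dot (vec (upper_coefs N (prm j))) z = 0 -> z = 0.
Proof.
move=> h hl hu; have hs : z 0 s = 0.
  by have := dot_sum_coefs j z; rewrite dotDl hl hu; lra.
have ht : z 0 t = 0.
  move: hl; rewrite dot_lower hs mulr0 subr0 => /eqP.
  by rewrite mulf_eq0 gt_eqF //= => /eqP.
have hv : z 0 v = 0.
  by have := normal_coordinate h; rewrite hs ht !normr0 addr0 normr_le0 => /eqP.
by apply/eqP; rewrite -dot_eq0 dot_self hs ht hv expr0n !addr0.
Qed.

Lemma cone_narrow j (y z : 'rV[R]_3) :
  let u := vec (normal_coefs N (prm j)) in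
  let g1 := vec (lower_coefs N (prm j)) in
  let g2 := vec (upper_coefs N (prm j)) in
  dot u y = 0 -> dot u z = 0 ->
  0 <= dot g1 y -> 0 <= dot g2 y -> 0 <= dot g1 z -> 0 <= dot g2 z ->
  enorm (dot (g1 + g2) z *: y - dot (g1 + g2) y *: z) <=
    3 / N%:R * dot (g1 + g2) y * enorm z.
Proof.
move=> /= uy uz.
set E := _ - _; have uE : dot (vec (normal_coefs N (prm j))) E = 0.
  by rewrite dotBr !dotZr uy uz !mulr0 subrr.
have Es : E 0 s = 0 by rewrite !mxE !dot_sum_coefs; ring.
have Et : E 0 t = 2 * (z 0 s * y 0 t - y 0 s * z 0 t).
  by rewrite !mxE !dot_sum_coefs; ring.
have Ev := normal_coordinate uE.
rewrite !dot_lower !dot_upper dot_sum_coefs.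
move: (j%:R - N%:R : R) => k hy1 hy2 hz1 hz2.
have ys : 0 <= y 0 s by lra.
have zs : 0 <= z 0 s by lra.
have zn : z 0 s <= enorm z.
  by rewrite -ler_sqr ?nnegrE ?enorm_ge0 // sqr_enorm sqr_le_dot.
have sn : 0 <= y 0 s * z 0 s by rewrite mulr_ge0.
have bEt : N%:R * `|E 0 t| <= 4 * (y 0 s * z 0 s).
  rewrite -{1}(gtr0_norm Npos) -normrM ler_norml Et.
  have := mulr_ge0 zs hy1; have := mulr_ge0 zs hy2.
  have := mulr_ge0 ys hz1; have := mulr_ge0 ys hz2; lra.
have : `|E 0 v| ^+ 2 <= `|E 0 t| ^+ 2.
  by rewrite ler_sqr ?nnegrE //; move: Ev; rewrite Es normr0 add0r.
rewrite !real_normK ?num_real // => Ev2.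
have nE : enorm E <= 3 / 2 * `|E 0 t|.
  have h0 : 0 <= 3 / 2 * `|E 0 t| by rewrite mulr_ge0 // divr_ge0.
  rewrite enorm_le //.
  by rewrite exprMn real_normK ?num_real // dot_self Es; move: (sqr_ge0 (E 0 t)); lra.
apply: le_trans nE _.
rewrite -(ler_pM2l Npos).
have -> : N%:R * (3 / N%:R * (2 * y 0 s) * enorm z) = 6 * (y 0 s * enorm z).
  by field; rewrite gt_eqF.
have : y 0 s * z 0 s <= y 0 s * enorm z by rewrite ler_wpM2l.
lra.
Qed.

Lemma cone_cover (z : 'rV[R]_3) : `|z 0 t| <= `|z 0 s| -> z 0 s != 0 ->
  exists2 j, (j <= 2 * N)%N &
    let g1 := vec (lower_coefs N (prm j)) in
    let g2 := vec (upper_coefs N (prm j)) in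
    0 < dot g1 z /\ 0 < dot g2 z \/ dot g1 z < 0 /\ dot g2 z < 0.
Proof.
move=> ts s0; pose r := z 0 t / z 0 s; have zt : z 0 t = r * z 0 s by rewrite divfK.
have : `|r| <= 1 by rewrite normrM normfV ler_pdivrMr ?normr_gt0 // mul1r.
rewrite ler_norml => /andP[r1 r2]; pose x := N%:R * r + N%:R.
have x0 : 0 <= x by rewrite /x; have := ler_wpM2l (ltW Npos) r1; lra.
have xN : x <= (2 * N)%:R by rewrite natrM /x; have := ler_wpM2l (ltW Npos) r2; lra.
have /andP[l1 l2] := truncn_itv x0.
exists (Num.truncn x); first by rewrite -(ler_nat R); exact: le_trans xN.
move=> g1 g2; rewrite /g1 /g2 !dot_lower !dot_upper zt; move: l1 l2; rewrite -natr1.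
move: ((Num.truncn x)%:R : R) => k l1 l2.
have -> : N%:R * (r * z 0 s) - (k - N%:R - 1) * z 0 s = (x - k + 1) * z 0 s.
  by rewrite /x; ring.
have -> : (k - N%:R + 1) * z 0 s - N%:R * (r * z 0 s) = (k + 1 - x) * z 0 s.
  by rewrite /x; ring.
have a1 : 0 < x - k + 1 by lra.
have a2 : 0 < k + 1 - x by lra.
rewrite !pmulr_rgt0 // !pmulr_rlt0 //.
by have [h|h|/eqP] := ltgtP (z 0 s) 0; [right|left|rewrite (negbTE s0)].
Qed.

End Cones.

Section Net.
Variable R : realType.

Lemma normal_net (N : nat) (w : 'rV[R]_3) : (3 < N)%N -> w != 0 ->
  exists v s t j1 j2, [/\ distinct3 v s t, (j1 <= 2 * N)%N, (j2 <= 2 * N)%N &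
  forall j, let u := cvec R (normal_coefs N (v, s, t, (j1, j2, j))) in
    dot u w != 0 /\
    forall q, dot q w = 0 ->
      enorm (q - (dot u q / dot u w) *: w) <= N%:R / (N%:R - 2) * enorm q].
Proof.
move=> N3 w0; have N4 : 4 <= (N%:R : R) by rewrite ler_nat.
have [v [s [t [vst ws wt]]]] := exists_distinct3_max (fun i => `|w 0 i|).
have wv : w 0 v != 0.
  apply: contraNneq w0 => e; rewrite -dot_eq0 (dot_self vst).
  by move: ws wt; rewrite e normr0 !normr_le0 => /eqP-> /eqP->; rewrite expr0n !addr0.
pose lam := N%:R / w 0 v.
have aux i : `|w 0 i| <= `|w 0 v| -> exists2 k, (k <= 2 * N)%N &
    `|k%:R - N%:R - lam * w 0 i| <= 1.
  move=> wi; have : `|w 0 i / w 0 v| <= 1.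
    by rewrite normrM normfV ler_pdivrMr ?normr_gt0 // mul1r.
  have -> : lam * w 0 i = N%:R * (w 0 i / w 0 v) by rewrite /lam; ring.
  move: (w 0 i / w 0 v) => r; rewrite ler_norml => /andP[r1 r2].
  have Npos : 0 <= (N%:R : R) by [].
  have x0 : 0 <= N%:R * r + N%:R by have := ler_wpM2l Npos r1; lra.
  have xN : N%:R * r + N%:R <= (2 * N)%:R.
    by rewrite natrM; have := ler_wpM2l Npos r2; lra.
  have /andP[l1 l2] := truncn_itv x0.
  exists (Num.truncn (N%:R * r + N%:R)).
    by rewrite -(ler_nat R); exact: le_trans xN.
  by move: l1 l2; rewrite -natr1 ler_norml; lra.
have [j1 hj1 b1] := aux s ws; have [j2 hj2 b2] := aux t wt.
exists v, s, t, j1, j2; split=> // j; set u := cvec R _.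
have du q : dot (u - lam *: w) q =
    (j1%:R - N%:R - lam * w 0 s) * q 0 s + (j2%:R - N%:R - lam * w 0 t) * q 0 t.
  rewrite dotBl (dot_normal N _ _ vst) dotZl /dot (sum_distinct3 _ vst) /lam.
  by field.
have nd : enorm (u - lam *: w) <= 2.
  rewrite enorm_le // du; set d := u - lam *: w.
  have /and3P[sv vt st] := vst.
  have ds : d 0 s = j1%:R - N%:R - lam * w 0 s.
    by rewrite !mxE /normal_coefs [s == v]eq_sym (negbTE sv) eqxx.
  have dt : d 0 t = j2%:R - N%:R - lam * w 0 t.
    by rewrite !mxE /normal_coefs ![t == _]eq_sym (negbTE vt) (negbTE st).
  rewrite ds dt -!expr2 -(real_normK (num_real (j1%:R - _ - _))).
  rewrite -(real_normK (num_real (j2%:R - _ - _))).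
  move: b1 b2 (normr_ge0 (j1%:R - N%:R - lam * w 0 s))
    (normr_ge0 (j2%:R - N%:R - lam * w 0 t)).
  by move: (`|_|) (`|_|) => a b; nra.
have lw : N%:R <= `|lam| * enorm w.
  rewrite /lam normrM normfV normr_nat mulrAC ler_pdivlMr ?normr_gt0 //.
  rewrite ler_wpM2l // -ler_sqr ?nnegrE ?enorm_ge0 // sqr_enorm.
  by rewrite real_normK ?num_real // sqr_le_dot.
have nw : 0 < enorm w by rewrite enorm_gt0.
have uw : (N%:R - 2) * enorm w <= `|dot u w|.
  have -> : dot u w = lam * dot w w + dot (u - lam *: w) w.
    by rewrite dotBl dotZl; ring.
  have := lerB_normD (lam * dot w w) (dot (u - lam *: w) w).
  rewrite normrM (ger0_norm (dot_ge0 _)) -sqr_enorm => h; apply: le_trans h.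
  have h1 := le_trans (dot_le_enorm _ w) (ler_wpM2r (ltW nw) nd).
  have := ler_wpM2r (ltW nw) lw; rewrite expr2; lra.
have uw0 : 0 < `|dot u w| by apply: lt_le_trans uw; rewrite mulr_gt0 //; lra.
split=> [|q qw]; first by rewrite -normr_gt0.
have uq : `|dot u q| <= 2 * enorm q.
  have -> : dot u q = dot (u - lam *: w) q by rewrite dotBl dotZl (dotC w) qw; ring.
  by apply: le_trans (dot_le_enorm _ _) _; rewrite ler_wpM2r ?enorm_ge0.
apply: le_trans (enormD _ _) _; rewrite enormN enormZ normrM normfV.
have N2 : 0 < N%:R - 2 :> R by lra.
have -> : N%:R / (N%:R - 2) * enorm q = enorm q + 2 * enorm q / (N%:R - 2).
  by field; rewrite gt_eqF.
rewrite lerD2l mulrAC ler_pdivrMr // [leRHS]mulrAC ler_pdivlMr // -mulrA.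
apply: ler_pM => //; first by rewrite mulr_ge0 ?enorm_ge0 // ltW.
by rewrite mulrC.
Qed.

Definition dominated_pairs (n : nat) (ok : nat -> bool) (k1 k2 : nat -> R)
    (good : nat -> nat -> Prop) : Prop :=
  let edge a b := exists c, [/\ (0 < c <= n)%N && ok c, c != a,
    k1 a <= k1 c /\ k2 a <= k2 c, k1 c + k2 c <= k1 b + k2 b & good a c] in
  forall a b, (0 < a <= n)%N -> (0 < b <= n)%N -> ok a -> ok b -> a != b ->
    (k1 a < k1 b -> k2 a <= k2 b -> edge a b) /\
    (k1 a = k1 b -> k2 a = k2 b -> edge a b \/ edge b a).

Definition key (u g p : 'rV[R]_3) : R := dot g p / dot u p.

Lemma dominated_slope (n N : nat) (p : nat -> 'rV[R]_3) (delta : R)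
    (v s t : 'I_3) (j1 j2 : nat) (a b : nat) :
  (3 < N)%N -> 0 < delta ->
  distinct3 v s t -> (j1 <= 2 * N)%N -> (j2 <= 2 * N)%N ->
  (forall a b, (0 < a <= n)%N -> (0 < b <= n)%N -> p a = p b -> a = b) ->
  (forall x, x \in params N ->
     let u := cvec R (normal_coefs N x) in
     dominated_pairs n (fun a => dot u (p a) != 0)
       (fun a => key u (cvec R (lower_coefs N x)) (p a))
       (fun a => key u (cvec R (upper_coefs N x)) (p a))
       (fun a c => delta <= line_dist (p a) (p c))) ->
  let u := cvec R (normal_coefs N (v, s, t, (j1, j2, 0%N))) in
  (0 < a <= n)%N -> (0 < b <= n)%N -> dot u (p a) != 0 -> dot u (p b) != 0 ->
  delta * `|(dot u (p b))^-1 - (dot u (p a))^-1| <=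
    (N%:R + 3) / (N%:R - 3) *
      enorm ((dot u (p b))^-1 *: p b - (dot u (p a))^-1 *: p a).
Proof.
move=> N3 d0 vst hj1 hj2 inj dom u an bn ua ub.
have N0 : (0 < N)%N by lia.
have vts : distinct3 v t s by move: vst; rewrite /distinct3 [t == s]eq_sym =>
  /and3P[-> -> ->].
have N4 : 4 <= (N%:R : R) by rewrite ler_nat.
have uE j : cvec R (normal_coefs N (v, s, t, (j1, j2, j))) = u.
  by apply/rowP => i; rewrite !mxE.
have uE' j : cvec R (normal_coefs N (v, t, s, (j2, j1, j))) = u.
  apply/rowP => i; rewrite !mxE /normal_coefs; case: (eqVneq i v) => // iv.
  case: (eqVneq i t) => [->|it].
    by case/and3P: vst => _ _; rewrite eq_sym => /negbTE->.
  case: (eqVneq i s) => // is'; have := mem_distinct3 i vst.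
  by rewrite !inE (negbTE iv) (negbTE it) (negbTE is').
pose cone g1 g2 := exists2 j, (j <= 2 * N)%N &
  (g1 = cvec R (lower_coefs N (v, s, t, (j1, j2, j))) /\
   g2 = cvec R (upper_coefs N (v, s, t, (j1, j2, j)))) \/
  (g1 = cvec R (lower_coefs N (v, t, s, (j2, j1, j))) /\
   g2 = cvec R (upper_coefs N (v, t, s, (j2, j1, j)))).
pose ok a := dot u (p a) != 0.
pose good a c := delta <= line_dist (p a) (p c).
have coneP g1 g2 : cone g1 g2 -> [/\
    dominated_pairs n ok (key u g1 \o p) (key u g2 \o p) good,
    (forall z, dot u z = 0 -> dot g1 z = 0 -> dot g2 z = 0 -> z = 0) &
    forall y z, dot u y = 0 -> dot u z = 0 ->
      0 <= dot g1 y -> 0 <= dot g2 y -> 0 <= dot g1 z -> 0 <= dot g2 z ->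
      enorm (dot (g1 + g2) z *: y - dot (g1 + g2) y *: z) <=
        3 / N%:R * dot (g1 + g2) y * enorm z].
  case=> j hj [[-> ->]|[-> ->]].
    have xp : (v, s, t, (j1, j2, j)) \in params N by exact: mem_params.
    split; first by have := dom _ xp; rewrite /= uE.
      by move=> z; rewrite -(uE j); exact: cone_eq0.
    by move=> y z; rewrite -(uE j); exact: cone_narrow.
  have xp : (v, t, s, (j2, j1, j)) \in params N by exact: mem_params.
  split; first by have := dom _ xp; rewrite /= uE'.
    by move=> z; rewrite -(uE' j); exact: cone_eq0.
  by move=> y z; rewrite -(uE' j); exact: cone_narrow.
pose rho a := (dot u (p a))^-1; pose X a := rho a *: p a.
have keyE g e : dot g (X e) = key u g (p e) by rewrite dotZr mulrC.
have uX e : ok e -> dot u (X e) = 1 by move=> ok_a; rewrite dotZr mulVf.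
have X_inj e c : ok e -> ok c -> rho e = rho c -> X e = X c -> p e = p c.
  move=> oka okc E0; rewrite /X -E0; apply: scalerI.
  by rewrite /rho invr_neq0.
have good_slope e c : ok e -> ok c -> p e != p c -> good e c ->
    delta * `|rho c - rho e| <= enorm (X c - X e).
  move=> oka okc pac g; apply: le_trans (line_dist_slope oka okc pac).
  by rewrite ler_wpM2r.
have good_neq e c : (0 < e <= n)%N -> (0 < c <= n)%N -> ok e -> ok c ->
    e != c -> good e c -> p e != p c /\ X c != X e.
  move=> ha hc oka okc ac g.
  have pac : p e != p c by apply: contraNneq ac => /inj->.
  split=> //; apply: contraNneq pac => E0; apply/eqP; apply: X_inj => //.
  have := good_slope _ _ oka okc; rewrite E0 subrr.
  have [Ep|pac /(_ isT g)] := eqVneq (p e) (p c); first by rewrite /rho Ep.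
  rewrite (_ : enorm 0 = 0); last by apply/eqP; rewrite enorm_eq0.
  by rewrite pmulr_rle0 // normr_le0 subr_eq0 => /eqP.
pose V (c : 'I_n.+1) := (0 < c)%N && ok c.
have VP (c : 'I_n.+1) : V c -> (0 < c <= n)%N /\ ok c.
  by case/andP => c0 ->; rewrite c0 -ltnS ltn_ord.
have a_lt : (a < n.+1)%N by case/andP: an.
have b_lt : (b < n.+1)%N by case/andP: bn.
have -> : (N%:R + 3) / (N%:R - 3) = (1 + 3 / N%:R) / (1 - 3 / N%:R) :> R.
  by field; do 2?split; lra.
apply: (@theta_graph_slope R _ V (X \o val) (rho \o val) u cone _ delta _ _ _ _ _
  _ _ (Ordinal a_lt) (Ordinal b_lt)).
- by rewrite divr_ge0 //= ltr_pdivrMr; lra.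
- exact: ltW.
- by move=> c /VP[_ /uX].
- by move=> g1 g2 y z /coneP[_ _]; exact.
- move=> z uz z0; have [st|/ltW ts] := lerP `|z 0 t| `|z 0 s|.
    have s0 : z 0 s != 0.
      apply: contraNneq z0 => s0; apply/eqP/(cone_eq0 N0 vst hj1 hj2 uz).
        move: st; rewrite s0 normr0 normr_le0 => /eqP t0.
        by rewrite dot_lower // s0 t0 !mulr0 subr0.
      move: st; rewrite s0 normr0 normr_le0 => /eqP t0.
      by rewrite dot_upper // s0 t0 !mulr0 subr0.
    have [j hj H] := cone_cover N0 j1 j2 vst st s0.
    by do 2!eexists; split; last exact: H; exists j => //; left.
  have t0 : z 0 t != 0.
    apply: contraNneq z0 => t0; move: ts; rewrite t0 normr0 normr_le0 => /eqP s0.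
    apply/eqP/(cone_eq0 N0 vst hj1 hj2 uz).
      by rewrite dot_lower // s0 t0 !mulr0 subr0.
    by rewrite dot_upper // s0 t0 !mulr0 subr0.
  have [j hj H] := cone_cover N0 j2 j1 vts ts t0.
  by do 2!eexists; split; last exact: H; exists j => //; right.
- move=> c d /VP[hc okc] /VP[hd okd] /= e.
  have [cd|cd] := eqVneq (val c) (val d); first by rewrite /= cd.
  pose G1 := cvec R (lower_coefs N (v, s, t, (j1, j2, 0%N))).
  pose G2 := cvec R (upper_coefs N (v, s, t, (j1, j2, 0%N))).
  have /coneP[D eq0 _] : cone G1 G2 by exists 0%N => //; left.
  have aux x y : (0 < x <= n)%N -> ok x -> X x = X y ->
    (exists c0 : nat, [/\ (0 < c0 <= n)%N && ok c0, c0 != x,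
      key u G1 (p x) <= key u G1 (p c0) /\ key u G2 (p x) <= key u G2 (p c0),
      key u G1 (p c0) + key u G2 (p c0) <= key u G1 (p y) + key u G2 (p y) &
      good x c0]) -> False.
    move=> hx okx exy [c0 [/andP[hc0 okc0] cx [k1 k2] ks g]].
    have [_ /negP] := good_neq x c0 hx hc0 okx okc0 (contra_neq esym cx) g.
    move: k1 k2 ks; rewrite -!keyE -exy => k1 k2 ks.
    apply; rewrite -subr_eq0; apply/eqP/eq0; rewrite dotBr.
    - by rewrite !uX // subrr.
    - by apply/eqP; rewrite subr_eq0 eq_le k1 andbT -(lerD2r (dot G2 (X x)));
        apply: le_trans ks; rewrite lerD2l.
    - by apply/eqP; rewrite subr_eq0 eq_le k2 andbT -(lerD2l (dot G1 (X x)));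
        apply: le_trans ks; rewrite lerD2r.
  have [_ /(_ _ _)[]] := D _ _ hc hd okc okd cd.
  + by rewrite /= -!keyE e.
  + by rewrite /= -!keyE e.
  + by move/(aux _ _ hc okc e).
  + by move/(aux _ _ hd okd (esym e)).
- move=> c d g1 g2 /VP[hc okc] /VP[hd okd] /coneP[D _ _] /= h1 h2.
  have cd : val c != val d by apply: contraTneq h1 => ->; rewrite ltxx.
  have [/(_ _ _)[]] := D _ _ hc hd okc okd cd.
  + by rewrite /= -!keyE.
  + by rewrite /= -!keyE ltW.
  move=> e [/andP[he oke] ec [k1 k2] ks g] _.
  have e_lt : (e < n.+1)%N by case/andP: he.
  have [pce Xce] := good_neq c e hc he okc oke (contra_neq esym ec) g.
  exists (Ordinal e_lt); split=> //=.
  + by rewrite /V /= oke; case/andP: he => ->.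
  + by rewrite !keyE.
  + by rewrite !dotDl !keyE.
  + exact: good_slope.
- by rewrite /V /ok /= ua andbT; case/andP: an.
- by rewrite /V /ok /= ub andbT; case/andP: bn.
Qed.

Theorem dominated_line_dist (n N : nat) (p : nat -> 'rV[R]_3) (delta eps : R) :
  (3 < N)%N -> 48 <= eps * (N%:R - 3) -> 0 <= delta ->
  (forall a b, (0 < a <= n)%N -> (0 < b <= n)%N -> p a = p b -> a = b) ->
  (forall a, (0 < a <= n)%N -> delta <= enorm (p a)) ->
  (forall x, x \in params N ->
     let u := cvec R (normal_coefs N x) in
     dominated_pairs n (fun a => dot u (p a) != 0)
       (fun a => key u (cvec R (lower_coefs N x)) (p a))
       (fun a => key u (cvec R (upper_coefs N x)) (p a))
       (fun a c => delta <= line_dist (p a) (p c))) ->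
  forall a b, (0 < a <= n)%N -> (0 < b <= n)%N -> p a != p b ->
    delta <= (1 + eps) * line_dist (p a) (p b).
Proof.
move=> N3 epsN d0 inj near dom a b an bn pab.
have N4 : 4 <= (N%:R : R) by rewrite ler_nat.
have eps0 : 0 < eps by rewrite -(pmulr_lgt0 _ (_ : 0 < N%:R - 3)); lra.
have [->|dn0] := eqVneq delta 0.
  by rewrite mulr_ge0 ?line_dist_ge0 // addr_ge0 // ltW.
have {dn0}d0 : 0 < delta by rewrite lt_def dn0.
have w0 : p b - p a != 0 by rewrite subr_eq0 eq_sym.
have [v [s [t [j1 [j2 [vst hj1 hj2 /(_ 0%N)]]]]]] := normal_net N3 w0.
set u := cvec R _ => /= -[uw H].
have [r [xw xd]] := line_dist_foot pab; have {H} := H _ xw; rewrite xd.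
set x := p a + r *: (p b - p a) in xw xd *.
set r' := dot u x / _; have -> : x - r' *: (p b - p a) =
    p a + (r - r') *: (p b - p a) by rewrite scalerBl addrA.
set q := _ + _ => nq.
have uq : dot u q = 0.
  have ux : dot u x = dot u (p a) + r * dot u (p b - p a).
    by rewrite (dotDr u (p a)) dotZr.
  by rewrite /q (dotDr u (p a)) dotZr mulrBl /r' divfK // ux; ring.
have l0 := line_dist_ge0 (p a) (p b).
suff dq : delta <= (N%:R + 3) / (N%:R - 3) * enorm q.
  apply: le_trans dq _.
  have h3 : 0 < N%:R - 3 :> R by lra.
  have h2 : 0 < N%:R - 2 :> R by lra.
  apply: le_trans (ler_wpM2l _ nq) _; first by rewrite divr_ge0 //; lra.
  rewrite mulrA ler_wpM2r //.
  rewrite mulf_div ler_pdivrMr ?mulr_gt0 //.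
  have : 48 * (N%:R - 2) <= eps * (N%:R - 3) * (N%:R - 2) by rewrite ler_wpM2r // ltW.
  lra.
have c1 : 1 <= (N%:R + 3) / (N%:R - 3) :> R by rewrite ler_pdivlMr; lra.
have q_le : enorm q <= (N%:R + 3) / (N%:R - 3) * enorm q.
  by rewrite ler_peMl ?enorm_ge0.
have [ua|ua] := eqVneq (dot u (p a)) 0.
  apply: le_trans (near _ an) _; rewrite (_ : p a = q) //.
  move: uq; rewrite /q dotDr ua add0r dotZr => /eqP.
  by rewrite mulf_eq0 (negbTE uw) orbF => /eqP->; rewrite scale0r addr0.
have [ub|ub] := eqVneq (dot u (p b)) 0.
  apply: le_trans (near _ bn) _; rewrite (_ : p b = q) //.
  move: uq; rewrite /q dotDr dotZr dotBr ub sub0r mulrN => /eqP.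
  rewrite -{1}(mul1r (dot u (p a))) -mulrBl mulf_eq0 (negbTE ua) orbF subr_eq0.
  by move=> /eqP<-; rewrite scale1r addrC subrK.
have uab : dot u (p a) != dot u (p b).
  by move: uw; rewrite dotBr subr_eq0 eq_sym.
have := dominated_slope N3 d0 vst hj1 hj2 inj dom an bn ua ub.
rewrite -/u (slope_foot ua ub uab uq) mulrA ler_pM2r // normr_gt0 subr_eq0.
by apply: contraNneq uab => /invr_inj->.
Qed.

End Net.

(** * Merge sort with nearest dominating elements *)

Definition seg (f : nat -> nat) (b l : nat) : seq nat := [seq f x | x <- iota b l].

Lemma segS f b l : seg f b l.+1 = rcons (seg f b l) (f (b + l)%N).
Proof. by rewrite /seg -addn1 iotaD map_cat /= cats1. Qed.

Lemma segD f b l l' : seg f b (l + l') = seg f b l ++ seg f (b + l) l'.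
Proof. by rewrite /seg iotaD map_cat. Qed.

Lemma eq_seg f g b l : (forall x, (b <= x < b + l)%N -> f x = g x) ->
  seg f b l = seg g b l.
Proof. by move=> H; apply/eq_in_map => x; rewrite mem_iota => /H. Qed.

Lemma segP f b l v :
  reflect (exists2 x, (b <= x < b + l)%N & v = f x) (v \in seg f b l).
Proof.
apply: (iffP mapP) => -[x h ->]; exists x => //; first by rewrite mem_iota in h.
by rewrite mem_iota.
Qed.

Lemma uniq_seg_inj f b l x y : uniq (seg f b l) -> (b <= x < b + l)%N ->
  (b <= y < b + l)%N -> f x = f y -> x = y.
Proof.
move=> u hx hy e; have eseg : seg f b l = mkseq (fun i => f (b + i)%N) l.
  by rewrite /mkseq /seg -[in LHS](addn0 b) iotaDl -map_comp.
rewrite eseg in u; move/mkseq_uniqP: u => inj.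
have := inj (x - b)%N (y - b)%N; rewrite !inE.
have -> : (b + (x - b) = x)%N by lia.
have -> : (b + (y - b) = y)%N by lia.
by move=> h; have := h _ _ e; lia.
Qed.

Section Merge.
Variables (R : realType) (K S : nat -> R) (D : nat -> nat -> R).

(* State of the merge of the decreasing runs A[b..mid] and A[mid+1..hi] into
   B[b..], where i and j are the next positions to be read and k the next to be
   written.  The index c is the S-minimum of the elements read from the second
   run (0 if there is none), and cur bounds the D-values examined. *)
Record merging (A : nat -> nat) (b mid hi i j k : nat) (B : nat -> nat)
    (c : nat) (cur : R) : Prop := Merging {
  mg_i : (b <= i <= mid.+1)%N;
  mg_j : (mid < j <= hi.+1)%N;
  mg_k : (k + mid.+1 = i + j)%N;
  mg_perm : perm_eq (seg B b (k - b)) (seg A b (i - b) ++ seg A mid.+1 (j - mid.+1));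
  mg_sorted : forall x y, (b <= x)%N -> (x < y < k)%N -> K (B y) <= K (B x);
  mg_left : forall x i', (b <= x < k)%N -> (i <= i' <= mid)%N ->
    K (A i') <= K (B x);
  mg_right : forall x j', (b <= x < k)%N -> (j <= j' <= hi)%N ->
    K (A j') <= K (B x);
  mg_cross : forall i' j', (i <= i' <= mid)%N -> (mid < j' < j)%N ->
    K (A i') <= K (A j');
  mg_best : c = 0%N /\ j = mid.+1 \/
    exists j', [/\ (mid < j' < j)%N, c = A j' &
      forall j'', (mid < j'' < j)%N -> S (A j') <= S (A j'')];
  mg_found : forall i' j', (b <= i' < i)%N -> (mid < j' <= hi)%N ->
    K (A i') <= K (A j') ->
    exists j'', [/\ (mid < j'' <= hi)%N, K (A i') <= K (A j''),
      S (A j'') <= S (A j') & cur <= D (A i') (A j'')] }.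

Section Step.
Variables (A : nat -> nat) (b mid hi : nat).
Hypothesis sortedL : forall x y, (b <= x)%N -> (x < y <= mid)%N -> K (A y) <= K (A x).
Hypothesis sortedR : forall x y, (mid < x)%N -> (x < y <= hi)%N -> K (A y) <= K (A x).
Hypothesis A_gt0 : forall x, (b <= x <= hi)%N -> (0 < A x)%N.

Lemma merging_init B cur : (b <= mid.+1)%N -> (mid <= hi)%N ->
  merging A b mid hi b mid.+1 b B 0 cur.
Proof.
move=> bm mh; split; try by [lia | move=> x y; lia].
by rewrite !subnn.
Qed.

Lemma perm_seg_upd (B : nat -> nat) k v l : (b <= k)%N ->
  perm_eq (seg B b (k - b)) l ->
  perm_eq (seg (upd B k v) b (k.+1 - b)) (v :: l).
Proof.
move=> bk p; have -> : (k.+1 - b = (k - b).+1)%N by lia.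
have ek : upd B k v (b + (k - b))%N = v by rewrite subnKC // /upd eqxx.
rewrite segS perm_rcons ek perm_cons; apply: perm_trans p.
by rewrite (@eq_seg _ B) // => x; rewrite /upd; case: eqP => //; lia.
Qed.

Lemma merging_right i j k B c cur c' :
  merging A b mid hi i j k B c cur -> (j <= hi)%N ->
  ((i <= mid)%N -> K (A i) <= K (A j)) ->
  (c' = A j /\ ((c == 0)%N || (S (A j) <= S c))) \/
    [/\ c' = c, c <> 0%N & S c <= S (A j)] ->
  merging A b mid hi i j.+1 k.+1 (upd B k (A j)) c' cur.
Proof.
case=> hi' hj hk perm srt lft rgt cross best found jhi ij hc.
have nk x : x <> k -> upd B k (A j) x = B x by rewrite /upd; case: eqP.
have ek : upd B k (A j) k = A j by rewrite /upd eqxx.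
have Aij i' : (i <= i' <= mid)%N -> K (A i') <= K (A j).
  move=> h; apply: le_trans (ij _); last by lia.
  have [->//|ne] := eqVneq i' i; apply: sortedL; lia.
split; try lia.
- have := perm_seg_upd (A j) (_ : (b <= k)%N) perm; move=> /(_ _)/perm_trans; apply; first by lia.
  have -> : (j.+1 - mid.+1 = (j - mid.+1).+1)%N by lia.
  rewrite segS subnKC; last by lia.
  by rewrite -rcons_cat perm_sym perm_rcons.
- move=> x y bx xy; have [e|ne] := eqVneq y k.
    by rewrite e ek nk; [apply: rgt|]; lia.
  by rewrite !nk; [apply: srt|..]; lia.
- move=> x i' hx hi''; have [e|ne] := eqVneq x k; first by rewrite e ek Aij.
  by rewrite nk; [apply: lft|]; lia.
- move=> x j' hx hj'; have [e|ne] := eqVneq x k.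
    by rewrite e ek; apply: sortedR; lia.
  by rewrite nk; [apply: rgt|]; lia.
- move=> i' j' hi'' hj'; have [->|ne] := eqVneq j' j; first exact: Aij.
  by apply: cross; lia.
- right; case: hc => [[-> hc]|[-> c0 hc]].
    exists j; split=> // [|j'' hj'']; first by lia.
    have [->//|ne] := eqVneq j'' j.
    case: best => [[_ e]|[j' [hj0 cE min]]]; first by lia.
    case/orP: hc => [/eqP c0|h].
      have Aj : (0 < A j')%N by apply: A_gt0; lia.
      by rewrite -cE c0 in Aj.
    by rewrite cE in h; apply: le_trans h (min _ _); lia.
  case: best => [[e _]|[j' [hj' cE min]]]; first by rewrite e in c0.
  exists j'; split=> // [|j'' hj'']; first by lia.
  have [->|ne] := eqVneq j'' j; first by rewrite -cE.
  by apply: min; lia.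
- exact: found.
Qed.

Lemma merging_left i j k B c cur cur' :
  merging A b mid hi i j k B c cur -> (i <= mid)%N ->
  ((j <= hi)%N -> K (A j) < K (A i)) -> cur' <= cur ->
  (c <> 0%N -> cur' <= D (A i) c) ->
  merging A b mid hi i.+1 j k.+1 (upd B k (A i)) c cur'.
Proof.
case=> hi' hj hk perm srt lft rgt cross best found imid ji' cc hc.
have ji : (j <= hi)%N -> K (A j) <= K (A i) by move/ji'/ltW.
have nk x : x <> k -> upd B k (A i) x = B x by rewrite /upd; case: eqP.
have ek : upd B k (A i) k = A i by rewrite /upd eqxx.
split; try lia.
- have := perm_seg_upd (A i) (_ : (b <= k)%N) perm; move=> /(_ _)/perm_trans; apply; first by lia.
  have -> : (i.+1 - b = (i - b).+1)%N by lia.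
  rewrite segS subnKC; last by lia.
  by rewrite cat_rcons -(cat1s _ (_ ++ _)) perm_catCA.
- move=> x y bx xy; have [e|ne] := eqVneq y k.
    by rewrite e ek nk; [apply: lft|]; lia.
  by rewrite !nk; [apply: srt|..]; lia.
- move=> x i' hx hi''; have [e|ne] := eqVneq x k.
    by rewrite e ek; apply: sortedL; lia.
  by rewrite nk; [apply: lft|]; lia.
- move=> x j' hx hj'; have [e|ne] := eqVneq x k.
    rewrite e ek; have [->|ne] := eqVneq j' j; first by apply: ji; lia.
    by apply: le_trans (ji _); [apply: sortedR|]; lia.
  by rewrite nk; [apply: rgt|]; lia.
- by move=> i' j' hi'' hj'; apply: cross; lia.
- exact: best.
- move=> i' j' hi'' hj' le; have [e|ne] := eqVneq i' i; last first.
    have [|z [hz k1 s1 d1]] := found i' j' _ hj' le; first by lia.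
    by exists z; split=> //; apply: le_trans d1.
  rewrite {i' hi''}e in le *.
  have jj : (j' < j)%N.
    rewrite ltnNge; apply/negP => h.
    have : K (A j') <= K (A j).
      by have [->//|ne] := eqVneq j' j; apply: sortedR; lia.
    by move/(le_trans le); rewrite leNgt ji' //; lia.
  case: best => [[_ e]|[z [hz cE min]]]; first by lia.
  exists z; split; first by lia.
  - by apply: cross; lia.
  - by apply: min; lia.
  - have Az : (0 < A z)%N by apply: A_gt0; lia.
    by rewrite -cE; apply: hc; rewrite cE; lia.
Qed.

End Step.

Definition block (f : nat -> nat) (m w t : nat) : seq nat :=
  seg f (t * w).+1 (minn (t * w + w) m - t * w).

Lemma block_double f m w t :
  block f m (2 * w) t = block f m w (2 * t) ++ block f m w (2 * t).+1.
Proof.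
rewrite /block.
have -> : (t * (2 * w) = 2 * t * w)%N by lia.
have -> : ((2 * t).+1 * w = 2 * t * w + w)%N by lia.
have /orP[le|gt] := leq_total m (2 * t * w + w).
  have -> : (minn (2 * t * w + w + w) m - (2 * t * w + w) = 0)%N by lia.
  by rewrite cats0; congr seg; lia.
have -> : (minn (2 * t * w + w) m - 2 * t * w = w)%N by lia.
rewrite -addSn -segD; congr seg; lia.
Qed.

Definition block_done (A0 : nat -> nat) (m w t : nat) (A : nat -> nat)
    (cur : R) : Prop :=
  [/\ perm_eq (block A m w t) (block A0 m w t),
      forall x y, (t * w < x)%N -> (x < y)%N -> (y <= minn (t * w + w) m)%N ->
        K (A y) <= K (A x) &
      forall x y, (t * w < x)%N -> (x < y)%N -> (y <= minn (t * w + w) m)%N ->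
        K (A0 x) <= K (A0 y) ->
        exists z, [/\ (x < z <= m)%N, K (A0 x) <= K (A0 z),
          S (A0 z) <= S (A0 y) & cur <= D (A0 x) (A0 z)]].

Lemma block_done_trans A0 m w t A A' cur cur' : cur' <= cur ->
  (forall x, (t * w < x)%N -> (x <= minn (t * w + w) m)%N -> A x = A' x) ->
  block_done A0 m w t A cur -> block_done A0 m w t A' cur'.
Proof.
move=> cc e [p s f]; split.
- by rewrite /block -(@eq_seg A A') // => x hx; apply: e; lia.
- by move=> x y h1 h2 h3; rewrite -!e; [apply: s|..]; lia.
- move=> x y h1 h2 h3 le; have [z [hz k1 s1 d1]] := f x y h1 h2 h3 le.
  by exists z; split=> //; apply: le_trans d1.
Qed.

Lemma block_done1 A0 m t cur : block_done A0 m 1 t A0 cur.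
Proof. by split=> // x y; lia. Qed.

Lemma block_done_merge A0 m w t A B i j k c cur cur' :
  let lo := (t * (2 * w))%N in
  let mid := minn (lo + w) m in
  let hi := minn (mid + w) m in
  (lo < m)%N -> cur' <= cur ->
  (forall t', block_done A0 m w t' A cur) ->
  merging A lo.+1 mid hi i j k B c cur' -> (hi < k)%N ->
  block_done A0 m (2 * w) t B cur'.
Proof.
move=> lo mid hi lom cc done [hi' hj hk perm srt _ _ _ _ found] kh.
have [p1 s1 f1] := done (2 * t)%N; have [p2 s2 f2] := done (2 * t).+1.
have e1 : (2 * t * w = lo)%N by rewrite /lo; lia.
have e2 : ((2 * t).+1 * w = lo + w)%N by rewrite /lo; lia.
have ei : i = mid.+1 by lia.
have ej : j = hi.+1 by lia.
have ek : k = hi.+1 by lia.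
rewrite {}ei {}ej {}ek in perm srt found.
have blk1 f : block f m w (2 * t) = seg f lo.+1 (mid.+1 - lo.+1).
  by rewrite /block e1; congr seg; lia.
have blk2 f : block f m w (2 * t).+1 = seg f mid.+1 (hi.+1 - mid.+1).
  rewrite /block e2; have /orP[le|gt] := leq_total (lo + w) m; last first.
    have -> : (minn (lo + w + w) m - (lo + w) = 0)%N by lia.
    by have -> : (hi.+1 - mid.+1 = 0)%N by lia.
  by congr seg; lia.
split.
- rewrite [X in perm_eq _ X]block_double; apply: perm_trans (perm_cat p1 p2).
  rewrite blk1 blk2 (_ : block B m _ t = seg B lo.+1 (hi.+1 - lo.+1)) //.
  by rewrite /block -/lo; congr seg; lia.
- by move=> x y h1 h2 h3; apply: srt; rewrite -/lo in h1 h3 *; lia.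
- rewrite -/lo => x y h1 h2 h3 le.
  have [ym|ym] := leqP y (lo + w).
    have [||z [hz k1 ss d1]] := f1 x y _ h2 _ le; rewrite ?e1; try lia.
    by exists z; split=> //; apply: le_trans d1.
  have [xm|xm] := leqP (lo + w).+1 x.
    have [||z [hz k1 ss d1]] := f2 x y _ h2 _ le; rewrite ?e2; try lia.
    by exists z; split=> //; apply: le_trans d1.
  have : A0 x \in seg A lo.+1 (mid.+1 - lo.+1).
    rewrite -blk1 (perm_mem p1) blk1; apply/segP; exists x => //; lia.
  case/segP => x' hx' ex.
  have : A0 y \in seg A mid.+1 (hi.+1 - mid.+1).
    rewrite -blk2 (perm_mem p2) blk2; apply/segP; exists y => //; lia.
  case/segP => y' hy' ey.
  have [|||z' []] := found x' y'; [by lia|by lia|by rewrite -ex -ey|].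
  rewrite -ex -ey => hz k1 ss d1.
  have : A z' \in seg A0 mid.+1 (hi.+1 - mid.+1).
    rewrite -blk2 -(perm_mem p2) blk2; apply/segP; exists z' => //; lia.
  case/segP => z hz' ez; rewrite ez in k1 ss d1.
  by exists z; split=> //; lia.
Qed.

End Merge.

(** * The program *)

(* Words: vm counts the points with u . p <> 0, vc is the best candidate in the
   current merge, and (vbi, vbj) the best pair found so far.  The cells of the
   reals 0 to 5 are the output. *)
Local Notation vn := 0%N (only parsing).
Local Notation vone := 1%N (only parsing).
Local Notation vm := 2%N (only parsing).
Local Notation vw := 3%N (only parsing).
Local Notation vlo := 4%N (only parsing).
Local Notation vb := 5%N (only parsing).
Local Notation vmid := 6%N (only parsing).
Local Notation vhi := 7%N (only parsing).
Local Notation vi := 8%N (only parsing).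
Local Notation vj := 9%N (only parsing).
Local Notation vk := 10%N (only parsing).
Local Notation vc := 11%N (only parsing).
Local Notation va := 12%N (only parsing).
Local Notation vx := 13%N (only parsing).
Local Notation vbi := 14%N (only parsing).
Local Notation vbj := 15%N (only parsing).
Local Notation vzero := 16%N (only parsing).

Local Notation rbest := 6%N (only parsing).
Local Notation rcur := 7%N (only parsing).
Local Notation ry := 8%N (only parsing).
Local Notation r1 := 11%N (only parsing).
Local Notation r2 := 12%N (only parsing).
Local Notation rdot := 13%N (only parsing).
Local Notation rzero := 14%N (only parsing).

Local Notation aS := 5%N (only parsing).

(* All the addresses and words of the program are below 1000 (n + 1). *)
Lemma lt_cell W n : (1000 * n.+1 <= W)%N -> forall c e, (c < 8)%N ->
  (e <= n.+2)%N -> (cell c e < W)%N.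
Proof. by rewrite /cell; lia. Qed.

Definition wadd d x y := Do (IArith IAdd d x y).
Definition wcopy d x := wadd d x vzero.

Definition rsum3 (f : nat -> rexpr) : rexpr :=
  RO RAdd (RO RAdd (f 0) (f 1)) (f 2).

Definition rcoord (x c : nat) : rexpr := RO RSub (RA c x) (RV (ry + c)).

Definition sqr_line_dist_expr : rexpr :=
  let p c := rcoord va c in
  let w c := RO RSub (rcoord vc c) (rcoord va c) in
  let d f g := rsum3 (fun c => RO RMul (f c) (g c)) in
  RO RDiv (RO RSub (RO RMul (d p p) (d w w)) (RO RMul (d p w) (d p w))) (d w w).

Definition eval_pair : cmd :=
  Seq (rset rcur sqr_line_dist_expr)
    (If (RLe rbest rcur) Skip
      (Seq (rset rbest (RV rcur)) (Seq (wcopy vbi va) (wcopy vbj vc)))).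

Definition take_right : cmd :=
  Seq (wload vx 0 vj) (Seq (wstore 1 vk vx)
    (Seq (wadd vj vj vone) (Seq (wadd vk vk vone)
      (If (ILe vone vc)
        (Seq (rset r1 (RA aS vc)) (Seq (rset r2 (RA aS vx))
          (If (RLe r1 r2) Skip (wcopy vc vx))))
        (wcopy vc vx))))).

Definition take_left : cmd :=
  Seq (wload va 0 vi) (Seq (wstore 1 vk va)
    (Seq (wadd vi vi vone) (Seq (wadd vk vk vone)
      (If (ILe vone vc) eval_pair Skip)))).

Definition merge_step (kc : nat) : cmd :=
  If (ILe vj vhi)
    (If (ILe vi vmid)
      (Seq (wload va 0 vi) (Seq (wload vx 0 vj)
        (Seq (rset r1 (RA kc va)) (Seq (rset r2 (RA kc vx))
          (If (RLe r1 r2) take_right take_left)))))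
      take_right)
    take_left.

Definition merge_init : cmd :=
  Seq (wadd vmid vlo vw) (Seq (If (ILe vmid vm) Skip (wcopy vmid vm))
    (Seq (wadd vhi vmid vw) (Seq (If (ILe vhi vm) Skip (wcopy vhi vm))
      (Seq (wadd vi vlo vone) (Seq (wadd vk vlo vone)
        (Seq (wadd vj vmid vone) (wcopy vc vzero))))))).

Definition merge_block (kc : nat) : cmd :=
  Seq merge_init (Seq (While (ILe vk vhi) (merge_step kc))
    (Seq (wcopy vlo vhi) (wadd vb vlo vone))).

Definition copy_step : cmd :=
  Seq (wload vx 1 vk) (Seq (wstore 0 vk vx) (wadd vk vk vone)).

Definition sort_pass (kc : nat) : cmd :=
  Seq (Seq (wcopy vlo vzero) (wcopy vb vone))
    (Seq (While (ILe vb vm) (merge_block kc))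
      (Seq (wcopy vk vone)
        (Seq (While (ILe vk vm) copy_step) (wadd vw vw vw)))).

Definition merge_sort (kc : nat) : cmd :=
  Seq (wcopy vw vone) (While (ILe vw vm) (sort_pass kc)).

Arguments upd T f d v k /.
Arguments upd2 T f c i v c' i' /.

Section Correctness.
Variables (R : realType) (W n : nat).
Hypothesis W_large : (1000 * n.+1 <= W)%N.
Variables (Y : nat -> R) (P : nat -> nat -> R).
Local Notation hst := (hst R).

Definition pt (e : nat) : 'rV[R]_3 := \row_(c < 3) (P c e - Y c).
Definition pair_dist (a b : nat) : R := sqr_line_dist (pt a) (pt b).

Record env (h : hst) : Prop := Env {
  env_n : wv h vn = n;
  env_one : wv h vone = 1%N;
  env_zero : wv h vzero = 0%N;
  env_rzero : rv h rzero = 0;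
  env_y : forall c, (c < 3)%N -> rv h (ry + c) = Y c;
  env_P : forall c e, (c < 3)%N -> ra h c e = P c e;
  env_bi : (0 < wv h vbi <= n)%N;
  env_bj : (0 < wv h vbj <= n)%N;
  env_bij : wv h vbi != wv h vbj;
  env_best : rv h rbest = pair_dist (wv h vbi) (wv h vbj) }.

Lemma env_setwv h x v : x \notin [:: vn; vone; vzero; vbi; vbj] ->
  env h -> env (setwv h x v).
Proof.
rewrite !inE !negb_or ![x == _]eq_sym.
move=> /and5P[/negbTE e0 /negbTE e1 /negbTE e2 /negbTE e3 /negbTE e4].
by case=> *; split; rewrite //= /upd ?e0 ?e1 ?e2 ?e3 ?e4.
Qed.

Lemma env_setwa h c i v : env h -> env (setwa h c i v).
Proof. by case=> *; split. Qed.

Lemma env_setrv h x v : x \notin [:: rbest; ry; ry.+1; ry.+2; rzero] ->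
  env h -> env (setrv h x v).
Proof.
rewrite !inE !negb_or ![x == _]eq_sym.
move=> /and5P[/negbTE e0 /negbTE e1 /negbTE e2 /negbTE e3 /negbTE e4].
case=> ? ? ? ? yE *; split; rewrite //= /upd ?e0 ?e4 //.
by move=> [|[|[|//]]] lt; rewrite -yE // ?e1 ?e2 ?e3.
Qed.

Lemma env_setra h c i v : (2 < c)%N -> env h -> env (setra h c i v).
Proof.
move=> c3; case=> *; split; rewrite //= => c' e lt; rewrite /upd2.
by rewrite (_ : c' == c = false) //=; [auto | lia].
Qed.

Lemma reval_sqr_line_dist (h : hst) :
  (forall c, (c < 3)%N -> rv h (ry + c) = Y c) ->
  (forall c e, (c < 3)%N -> ra h c e = P c e) ->
  reval sqr_line_dist_expr h = pair_dist (wv h va) (wv h vc).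
Proof.
move=> yE PE; rewrite /pair_dist /sqr_line_dist.
rewrite /dot !big_ord_recl !big_ord0 !mxE /= /bump /=.
rewrite !PE // (yE 0%N) // (yE 1%N) // (yE 2%N) //.
by congr (_ / _); ring.
Qed.

Lemma wpb_wcopy d x (Q : hst -> Prop) h : wv h vzero = 0%N -> (d < 32)%N -> (x < 32)%N ->
  (wv h x < W)%N -> Q (setwv h d (wv h x)) -> wpb W (wcopy d x) Q h.
Proof.
move=> z d32 x32 lt q.
by apply: wpb_warith; rewrite //= z addn0.
Qed.

Lemma wpb_eval_pair (Q : hst -> Prop) h : env h ->
  (0 < wv h va <= n)%N -> (0 < wv h vc <= n)%N -> wv h va != wv h vc ->
  (forall h', env h' -> (forall x, x != vbi -> x != vbj -> wv h' x = wv h x) ->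
     wa h' = wa h -> ra h' = ra h -> rv h' rbest <= rv h rbest ->
     rv h' rbest <= pair_dist (wv h va) (wv h vc) -> Q h') ->
  wpb W eval_pair Q h.
Proof.
move=> E ha hc ac q; have ED := reval_sqr_line_dist (env_y E) (env_P E).
have cW := lt_cell W_large.
apply: wpb_seq; apply: wpb_rset => //; first by lia.
  by rewrite /=; do ?split; try (apply: cW; lia); lia.
rewrite ED; apply: wpb_if => //= le.
  by apply: wpb_skip; apply: q => //; exact: env_setrv.
rewrite -ltNge in le.
apply: wpb_seq; apply: wpb_rset => //=; [by lia..|].
have [z En] := (env_zero E, env_n E).
apply: wpb_seq; apply: wpb_wcopy => //=; first by lia.
apply: wpb_wcopy => //=; first by lia.
apply: q => //=.
- by case: E => ? ? ? ? yE *; split=> //= c lt; rewrite -yE.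
- by move=> x /negbTE-> /negbTE->.
- exact: ltW.
Qed.

Section Block.
Variables (Aw Bw : nat -> nat) (Ra : nat -> nat -> R) (b mid hi w m kc : nat).
Variable cur0 : R.
Local Notation K := (Ra kc).
Local Notation S := (Ra aS).
Hypotheses (kc8 : (kc < 8)%N) (b_gt0 : (0 < b)%N) (b_mid : (b <= mid.+1)%N).
Hypotheses (mid_hi : (mid <= hi)%N) (hi_n : (hi <= n)%N).
Hypothesis A_range : forall x, (b <= x <= hi)%N -> (0 < Aw x <= n)%N.
Hypothesis A_distinct : forall x y, (b <= x <= mid)%N -> (mid < y <= hi)%N ->
  Aw x != Aw y.
Hypothesis sortedL : forall x y, (b <= x)%N -> (x < y <= mid)%N -> K (Aw y) <= K (Aw x).
Hypothesis sortedR : forall x y, (mid < x)%N -> (x < y <= hi)%N -> K (Aw y) <= K (Aw x).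

Record minv (rem : nat) (h : hst) : Prop := Minv {
  mi_env : env h;
  mi_rem : rem = (hi.+1 - wv h vk)%N;
  mi_m : wv h vm = m; mi_w : wv h vw = w;
  mi_mid : wv h vmid = mid; mi_hi : wv h vhi = hi;
  mi_A : wa h 0 = Aw; mi_ra : ra h = Ra;
  mi_B : forall x, (x < b)%N -> wa h 1 x = Bw x;
  mi_cur : rv h rbest <= cur0;
  mi_merging : merging K S pair_dist Aw b mid hi (wv h vi) (wv h vj) (wv h vk)
    (wa h 1) (wv h vc) (rv h rbest) }.

Let cellW := lt_cell W_large.

Let A_gt0 x : (b <= x <= hi)%N -> (0 < Aw x)%N.
Proof. by move/A_range/andP => []. Qed.

Lemma best_range rem h : minv rem h -> (wv h vc <= n)%N.
Proof.
case=> _ _ _ _ _ _ _ _ _ _ [_ hj _ _ _ _ _ _ best _].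
case: best => [[-> //]|[j' [hj' -> _]]].
have := A_range (x := j'); lia.
Qed.

Lemma wpb_take_right rem h : minv rem h -> (wv h vk <= hi)%N ->
  (wv h vj <= hi)%N ->
  ((wv h vi <= mid)%N -> K (Aw (wv h vi)) <= K (Aw (wv h vj))) ->
  wpb W take_right (minv rem.-1) h.
Proof.
move=> I kh jh le; have cn := best_range I.
case: I => E er em ew emid ehi eA eR eB ecur M.
have [M1 M2 M3 _ _ _ _ _ best _] := M.
have hAj : (0 < Aw (wv h vj) <= n)%N by apply: A_range; lia.
have e1 := env_one E; have ez := env_zero E.
apply: wpb_seq; apply: wpb_wload => //; first by apply: cellW; lia.
apply: wpb_seq; apply: wpb_wstore => //=; first by apply: cellW; lia.
apply: wpb_seq; apply: wpb_warith => //=; first by lia.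
apply: wpb_seq; apply: wpb_warith => //=; first by lia.
rewrite e1 eA.
have step c' : (c' = Aw (wv h vj) /\ ((wv h vc == 0)%N || (S (Aw (wv h vj)) <= S (wv h vc)))) \/
    [/\ c' = wv h vc, wv h vc <> 0%N & S (wv h vc) <= S (Aw (wv h vj))] ->
    merging K S pair_dist Aw b mid hi (wv h vi) (wv h vj).+1 (wv h vk).+1
      (upd (wa h 1) (wv h vk) (Aw (wv h vj))) c' (rv h rbest).
  exact: merging_right.
have fin c' h' : env h' -> (forall x, x \notin [:: vj; vk; vc; vx] -> wv h' x = wv h x) ->
    wv h' vj = (wv h vj).+1 -> wv h' vk = (wv h vk).+1 -> wv h' vc = c' ->
    wa h' 0 = Aw -> wa h' 1 = upd (wa h 1) (wv h vk) (Aw (wv h vj)) ->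
    ra h' = Ra -> rv h' rbest = rv h rbest ->
    (c' = Aw (wv h vj) /\ ((wv h vc == 0)%N || (S (Aw (wv h vj)) <= S (wv h vc)))) \/
    [/\ c' = wv h vc, wv h vc <> 0%N & S (wv h vc) <= S (Aw (wv h vj))] ->
    minv rem.-1 h'.
  move=> E' fr ej ek ec eA' eB' eR' ebest hc'.
  split; rewrite ?ej ?ek ?ec ?ebest ?fr //; first by rewrite er subnS.
    move=> x hx; rewrite eB' /= -eB //; case: eqP => // ex; lia.
  by rewrite eB'; exact: step.
have aux x : x \notin [:: vj; vk; vc; vx] ->
    [/\ x != vj, x != vk, x != vc & x != vx] by rewrite !inE !negb_or => /and4P.
apply: wpb_if => //=; rewrite e1 => c0.
  apply: wpb_seq; apply: wpb_rset => //=; [by lia|by apply: cellW; lia|].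
  apply: wpb_seq; apply: wpb_rset => //=; [by lia|by apply: cellW; lia|].
  apply: wpb_if => //=; rewrite eR => le'.
    apply: wpb_skip; apply: (fin (wv h vc)) => //=.
    - by do ?[apply: env_setrv => // | apply: env_setwv => // | apply: env_setwa].
    - by move=> x /aux[/negbTE f1 /negbTE f2 /negbTE f3 /negbTE f4];
        rewrite ?f1 ?f2 ?f3 ?f4.
    - by rewrite addn1.
    - by rewrite addn1.
    - by right; split=> //; lia.
  apply: wpb_wcopy => //=; first by lia.
  apply: (fin (Aw (wv h vj))) => //=.
  - by do ?[apply: env_setrv => // | apply: env_setwv => // | apply: env_setwa].
  - by move=> x /aux[/negbTE f1 /negbTE f2 /negbTE f3 /negbTE f4];
        rewrite ?f1 ?f2 ?f3 ?f4.
  - by rewrite addn1.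
  - by rewrite addn1.
  - by left; split=> //; rewrite (ltW (_ : _ < _)) ?orbT // ltNge.
apply: wpb_wcopy => //=; first by lia.
apply: (fin (Aw (wv h vj))) => //=.
- by do ?[apply: env_setrv => // | apply: env_setwv => // | apply: env_setwa].
- by move=> x /aux[/negbTE f1 /negbTE f2 /negbTE f3 /negbTE f4];
        rewrite ?f1 ?f2 ?f3 ?f4.
- by rewrite addn1.
- by rewrite addn1.
- by left; split=> //; apply/orP; left; lia.
Qed.

Lemma wpb_take_left rem h : minv rem h -> (wv h vk <= hi)%N ->
  (wv h vi <= mid)%N ->
  ((wv h vj <= hi)%N -> K (Aw (wv h vj)) < K (Aw (wv h vi))) ->
  wpb W take_left (minv rem.-1) h.
Proof.
move=> I kh ih lt; have cn := best_range I.
case: I => E er em ew emid ehi eA eR eB ecur M.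
have [M1 M2 M3 _ _ _ _ _ best _] := M.
have hAi : (0 < Aw (wv h vi) <= n)%N by apply: A_range; lia.
have e1 := env_one E; have ez := env_zero E.
apply: wpb_seq; apply: wpb_wload => //; first by apply: cellW; lia.
apply: wpb_seq; apply: wpb_wstore => //=; first by apply: cellW; lia.
apply: wpb_seq; apply: wpb_warith => //=; first by lia.
apply: wpb_seq; apply: wpb_warith => //=; first by lia.
rewrite e1 eA.
set h1 := setwv _ vk _.
have E1 : env h1 by do ?[apply: env_setwv => // | apply: env_setwa].
have aux x : x \notin [:: vi; vk; va; vbi; vbj] ->
    [/\ x != vi, x != vk, x != va, x != vbi & x != vbj].
  by rewrite !inE !negb_or => /and5P.
have fin h' : env h' -> (forall x, x != vbi -> x != vbj -> wv h' x = wv h1 x) ->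
    wa h' = wa h1 -> ra h' = ra h1 -> rv h' rbest <= rv h1 rbest ->
    (wv h vc <> 0%N -> rv h' rbest <= pair_dist (Aw (wv h vi)) (wv h vc)) ->
    minv rem.-1 h'.
  move=> E' fr eA' eR' le1 le2; split => //; rewrite ?fr ?eA' ?eR' //=.
  - by rewrite addn1 er subnS.
  - move=> x hx; rewrite -eB //; case: eqP => // ex; lia.
  - exact: le_trans ecur.
  - rewrite !addn1.
    by apply: (@merging_left _ _ _ _ _ _ _ _ sortedL sortedR A_gt0 _ _ _ _ _ _ _ M).
apply: wpb_if => //=; rewrite e1 => c0; last first.
  by apply: wpb_skip; apply: fin => //; lia.
apply: wpb_eval_pair => //=.
- by lia.
- case: best => [[e _]|[j' [hj' -> _]]]; first by lia.
  by apply: A_distinct; lia.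
- by move=> h' E' f1 f2 f3 f4 f5; apply: fin.
Qed.

Lemma wpb_merge_step rem h : minv rem h -> (wv h vk <= hi)%N ->
  wpb W (merge_step kc) (minv rem.-1) h.
Proof.
move=> I kh; have [E er em ew emid ehi eA eR eB ecur M] := I.
have [M1 M2 M3 _ _ _ _ _ _ _] := M.
apply: wpb_if => //=; rewrite ehi => jh; last by apply: wpb_take_left => //; lia.
apply: wpb_if => //=; rewrite emid => ih; last by apply: wpb_take_right => //; lia.
have hAi : (0 < Aw (wv h vi) <= n)%N by apply: A_range; lia.
have hAj : (0 < Aw (wv h vj) <= n)%N by apply: A_range; lia.
apply: wpb_seq; apply: wpb_wload => //=; first by apply: cellW; lia.
apply: wpb_seq; apply: wpb_wload => //=; first by apply: cellW; lia.
rewrite eA.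
apply: wpb_seq; apply: wpb_rset => //=; [by rewrite kc8|by lia|by apply: cellW; lia|].
apply: wpb_seq; apply: wpb_rset => //=; [by rewrite kc8|by lia|by apply: cellW; lia|].
set h1 := setrv _ r2 _.
have I1 : minv rem h1.
  split => //.
  by do ?[apply: env_setrv => // | apply: env_setwv => // | apply: env_setwa].
apply: wpb_if => //=; rewrite eR => le.
  exact: wpb_take_right.
by apply: wpb_take_left => //= _; rewrite ltNge.
Qed.

Lemma wp_merge_loop rem h : minv rem h ->
  wp W (While (ILe vk vhi) (merge_step kc)) (rem * (tc (merge_step kc)).+1).+1
    (fun h' => exists2 rem', minv rem' h' & (hi < wv h' vk)%N) h.
Proof.
apply: (@wp_loop _ _ _ _ _ minv) => // {rem} rem {}h I /=.
  rewrite (mi_hi I) -ltnNge => lt.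
  by exists rem.
rewrite (mi_hi I) => le; have er := mi_rem I.
exists rem.-1; first by lia.
have -> : ((rem - rem.-1) * tc (merge_step kc) = tc (merge_step kc))%N.
  by have -> : (rem - rem.-1 = 1)%N; [lia|rewrite mul1n].
exact: wpb_merge_step.
Qed.

End Block.
End Correctness.

Section Sort.
Variables (R : realType) (W n : nat).
Hypothesis W_large : (1000 * n.+1 <= W)%N.
Variables (Y : nat -> R) (P : nat -> nat -> R).
Local Notation hst := (hst R).
Local Notation env := (env n Y P).
Local Notation pair_dist := (pair_dist Y P).

Variables (A0 : nat -> nat) (Ra : nat -> nat -> R) (m kc : nat).
Local Notation K := (Ra kc).
Local Notation S := (Ra aS).
Hypotheses (kc8 : (kc < 8)%N) (m_n : (m <= n)%N).
Hypothesis A0_uniq : uniq (seg A0 1 m).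
Hypothesis A0_range : forall x, (0 < x <= m)%N -> (0 < A0 x <= n)%N.

Local Notation done := (block_done K S pair_dist A0 m).

Let cellW := lt_cell W_large.

Lemma done_mem w t A cur x : done w t A cur -> (t * w < x)%N ->
  (x <= minn (t * w + w) m)%N ->
  exists2 z, (t * w < z <= minn (t * w + w) m)%N & A x = A0 z.
Proof.
case=> p _ _ h1 h2; have : A x \in block A m w t by apply/segP; exists x => //; lia.
by rewrite (perm_mem p) => /segP[z hz ->]; exists z => //; lia.
Qed.

Record sinv (w : nat) (cur : R) (h : hst) : Prop := Sinv {
  si_env : env h; si_m : wv h vm = m; si_w : wv h vw = w; si_ra : ra h = Ra;
  si_cur : rv h rbest <= cur }.

Section Pass.
Variables (w : nat) (Aw : nat -> nat) (cur0 : R).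
Hypotheses (w_gt0 : (0 < w)%N) (w_m : (w <= m)%N).
Hypothesis Aw_done : forall t, done w t Aw cur0.

Record binv (k : nat) (h : hst) : Prop := Binv {
  bi_sinv : sinv w cur0 h;
  bi_A : wa h 0 = Aw;
  bi_b : wv h vb = (wv h vlo).+1;
  bi_k : k = (m - wv h vlo)%N;
  bi_t : exists2 t, wv h vlo = minn (t * (2 * w)) m &
    forall t', (t' < t)%N -> done (2 * w) t' (wa h 1) (rv h rbest) }.

Definition block_cost : nat :=
  tc merge_init + (tc (merge_step kc)).+1 + 1 +
  tc (Seq (wcopy vlo vhi) (wadd vb vlo vone)) + 2.

Lemma wp_merge_block k h : binv k h -> (wv h vb <= m)%N ->
  exists2 k', (k' < k)%N &
    wp W (merge_block kc) ((k - k') * block_cost) (binv k') h.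
Proof.
move=> [[E em ew eR ecur] eA eb ek [t elo dn]] bm.
have e1 := env_one E; have ez := env_zero E.
set lo := wv h vlo in eb ek elo *.
have lom : (lo < m)%N by lia.
have lot : lo = (t * (2 * w))%N by lia.
pose mid := minn (lo + w) m; pose hi := minn (mid + w) m.
exists (m - hi)%N; first by lia.
have -> : (k - (m - hi) = hi - lo)%N by lia.
have es1 : (2 * t * w = lo)%N by lia.
have es2 : ((2 * t).+1 * w = lo + w)%N by lia.
have memL x : (lo < x <= mid)%N -> exists2 z, (lo < z <= mid)%N & Aw x = A0 z.
  by move=> hx; have [||z hz ->] := done_mem (x := x) (Aw_done (2 * t)%N);
    rewrite ?es1; [lia|lia|]; exists z => //; move: hz; rewrite es1; lia.
have memR x : (mid < x <= hi)%N -> exists2 z, (lo + w < z <= hi)%N & Aw x = A0 z.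
  by move=> hx; have [||z hz ->] := done_mem (x := x) (Aw_done (2 * t).+1);
    rewrite ?es2; [lia|lia|]; exists z => //; move: hz; rewrite es2; lia.
have A_range x : (lo.+1 <= x <= hi)%N -> (0 < Aw x <= n)%N.
  move=> hx; case: (leqP x mid) => xm.
    by have [|z hz ->] := memL x; [lia|apply: A0_range; lia].
  by have [|z hz ->] := memR x; [lia|apply: A0_range; lia].
have A_distinct x y : (lo.+1 <= x <= mid)%N -> (mid < y <= hi)%N -> Aw x != Aw y.
  move=> hx hy; have [|z hz ->] := memL x; first by lia.
  have [|z' hz' ->] := memR y; first by lia.
  by apply/eqP => e; have := uniq_seg_inj A0_uniq _ _ e; lia.
have sortedL x y : (lo.+1 <= x)%N -> (x < y <= mid)%N -> K (Aw y) <= K (Aw x).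
  by move=> h1 h2; have [_ srt _] := Aw_done (2 * t)%N; apply: srt; rewrite ?es1; lia.
have sortedR x y : (mid < x)%N -> (x < y <= hi)%N -> K (Aw y) <= K (Aw x).
  by move=> h1 h2; have [_ srt _] := Aw_done (2 * t).+1; apply: srt; rewrite ?es2; lia.
pose MI := minv n Y P Aw (wa h 1) Ra lo.+1 mid hi w m kc (rv h rbest).
apply: (@wp_conseq _ _ _ (tc merge_init + (((hi - lo) * (tc (merge_step kc)).+1).+1 +
   tc (Seq (wcopy vlo vhi) (wadd vb vlo vone))).+1).+1 _ (binv (m - hi))) => //.
  have -> : (hi - lo = (hi - lo).-1.+1)%N by lia.
  rewrite /block_cost; move: (tc _) (tc _) (tc _) (hi - lo).-1 => a b c d; nia.
apply: wp_seq; rewrite -/(wpb W merge_init _ h).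
suff init h1 : MI (hi - lo)%N h1 ->
    wp W (Seq (While (ILe vk vhi) (merge_step kc))
      (Seq (wcopy vlo vhi) (wadd vb vlo vone)))
     (((hi - lo) * (tc (merge_step kc)).+1).+1 +
      tc (Seq (wcopy vlo vhi) (wadd vb vlo vone))).+1 (binv (m - hi)) h1.
  have emid1 : eval_iop IAdd lo w = (lo + w)%N by [].
  apply: wpb_seq; apply: wpb_warith => //=; first by rewrite -/lo ew; lia.
  rewrite -/lo ew; apply: wpb_seq.
  have step2 h2 : env h2 -> wv h2 vm = m -> wv h2 vw = w -> ra h2 = Ra ->
      rv h2 rbest = rv h rbest -> wa h2 = wa h -> wv h2 vlo = lo ->
      wv h2 vmid = mid ->
      wpb W (Seq (wadd vhi vmid vw) (Seq (If (ILe vhi vm) Skip (wcopy vhi vm))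
      (Seq (wadd vi vlo vone) (Seq (wadd vk vlo vone)
        (Seq (wadd vj vmid vone) (wcopy vc vzero)))))) (wp W (Seq (While (ILe vk vhi) (merge_step kc))
      (Seq (wcopy vlo vhi) (wadd vb vlo vone)))
     (((hi - lo) * (tc (merge_step kc)).+1).+1 +
      tc (Seq (wcopy vlo vhi) (wadd vb vlo vone))).+1 (binv (m - hi))) h2.
    move=> E2 em2 ew2 eR2 er2 ea2 el2 emid2.
    have e12 := env_one E2; have ez2 := env_zero E2.
    apply: wpb_seq; apply: wpb_warith => //=; first by rewrite emid2 ew2; lia.
    rewrite emid2 ew2; apply: wpb_seq.
    have step3 h3 : env h3 -> wv h3 vm = m -> wv h3 vw = w -> ra h3 = Ra ->
        rv h3 rbest = rv h rbest -> wa h3 = wa h -> wv h3 vlo = lo ->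
        wv h3 vmid = mid -> wv h3 vhi = hi ->
        wpb W (Seq (wadd vi vlo vone) (Seq (wadd vk vlo vone)
        (Seq (wadd vj vmid vone) (wcopy vc vzero)))) (wp W (Seq (While (ILe vk vhi) (merge_step kc))
      (Seq (wcopy vlo vhi) (wadd vb vlo vone)))
     (((hi - lo) * (tc (merge_step kc)).+1).+1 +
      tc (Seq (wcopy vlo vhi) (wadd vb vlo vone))).+1 (binv (m - hi))) h3.
      move=> E3 em3 ew3 eR3 er3 ea3 el3 emid3 ehi3.
      have e13 := env_one E3; have ez3 := env_zero E3.
      apply: wpb_seq; apply: wpb_warith => //=; first by rewrite el3 e13; lia.
      apply: wpb_seq; apply: wpb_warith => //=; first by rewrite el3 e13; lia.
      apply: wpb_seq; apply: wpb_warith => //=; first by rewrite emid3 e13; lia.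
      apply: wpb_wcopy => //=; first by lia.
      apply: init; split=> //=.
      - by do ?[apply: env_setwv => //].
      - by rewrite el3 e13; lia.
      - by rewrite ea3 eA.
      - by rewrite ea3.
      - by rewrite er3.
      - rewrite el3 e13 emid3 ez3 er3 ea3 !addn1; apply: merging_init; lia.
    apply: wpb_if => //=; rewrite em2 => le.
      apply: wpb_skip; apply: step3 => //=; last by rewrite /hi; lia.
      by apply: env_setwv.
    apply: wpb_wcopy => //=; first by lia.
    apply: step3 => //=; last by rewrite em2 /hi; lia.
    by do ?[apply: env_setwv => //].
  apply: wpb_if => //=; rewrite em => le.
    apply: wpb_skip; apply: step2 => //=; last by rewrite /mid; lia.
    by apply: env_setwv.
  apply: wpb_wcopy => //=; first by lia.
  apply: step2 => //=; last by rewrite em /mid; lia.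
  by do ?[apply: env_setwv => //].
move=> I; apply: wp_seq.
apply: (wp_conseq (leqnn _)) _ (wp_merge_loop W_large kc8 _ _ _ _ A_range A_distinct
  sortedL sortedR I); try by lia.
move=> h2 [rem [E2 er em2 ew2 emid2 ehi2 eA2 eR2 eB2 ecur2 M2] kh].
have [ez2 e12] := (env_zero E2, env_one E2).
apply: wpb_seq; apply: wpb_wcopy => //=; first by lia.
apply: wpb_warith => //=; first by lia.
split=> //=.
- split=> //=; last by apply: le_trans ecur2 _.
  by do ?[apply: env_setwv => //].
- by rewrite e12 addn1.
- by rewrite ehi2.
- exists t.+1; first by rewrite ehi2 /hi /mid; lia.
  move=> t'; rewrite ltnS leq_eqVlt => /orP[/eqP->|t't].
    apply: (@block_done_merge _ _ _ _ A0 m w t Aw _ _ _ _ _ _ _ _ _ Aw_done).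
    + by rewrite -lot.
    + exact: le_trans ecur2 ecur.
    + by rewrite -lot -/mid -/hi; exact: M2.
    + by rewrite -lot -/mid -/hi.
  apply: block_done_trans (dn _ t't) => // x hx1 hx2.
  rewrite eB2 //; rewrite lot; have : (t' * (2 * w) + 2 * w <= t * (2 * w))%N.
    by rewrite -mulSnr leq_mul2r t't orbT.
  by lia.
Qed.

Record cinv (B : nat -> nat) (cur : R) (k : nat) (h : hst) : Prop := Cinv {
  ci_sinv : sinv w cur0 h; ci_rbest : rv h rbest = cur; ci_B : wa h 1 = B;
  ci_vk : (0 < wv h vk)%N; ci_k : k = (m.+1 - wv h vk)%N;
  ci_A : forall x, (0 < x < wv h vk)%N -> wa h 0 x = B x }.

Lemma wp_copy B cur k h : cinv B cur k h ->
  wp W (While (ILe vk vm) copy_step) (k * (tc copy_step).+1).+1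
    (fun h' => [/\ sinv w cur0 h', rv h' rbest = cur &
       forall x, (0 < x <= m)%N -> wa h' 0 x = B x]) h.
Proof.
apply: (@wp_loop _ _ _ _ _ (cinv B cur)) => // {k} k {}h [[E em ew eR ec] er eB k0 ek eA] /=.
  by rewrite em => lt; split=> // x hx; apply: eA; lia.
rewrite em => le; exists k.-1; first by lia.
have -> : ((k - k.-1) * tc copy_step = tc copy_step)%N.
  by have -> : (k - k.-1 = 1)%N; [lia|rewrite mul1n].
rewrite -/(wpb W copy_step _ h).
apply: wpb_seq; apply: wpb_wload => //; first by apply: cellW; lia.
apply: wpb_seq; apply: wpb_wstore => //=; first by apply: cellW; lia.
have e1 := env_one E.
apply: wpb_warith => //=; first by lia.
rewrite e1 eB; split=> //=.
- split=> //=.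
  by do ?[apply: env_setwv => // | apply: env_setwa].
- by rewrite addn1.
- by rewrite addn1 ek subnS.
- rewrite addn1 => x hx; case: eqP => [->//|ne]; apply: eA; lia.
Qed.

Definition pass_cost : nat :=
  (tc (Seq (wcopy vlo vzero) (wcopy vb vone)) + (n * block_cost.+1).+1 +
   tc (wcopy vk vone) + (n * (tc copy_step).+1).+1 + tc (wadd vw vw vw) + 4)%N.

Lemma wp_sort_pass h : sinv w cur0 h -> wa h 0 = Aw ->
  wp W (sort_pass kc) pass_cost (fun h' => sinv (2 * w) cur0 h' /\
    forall t, done (2 * w) t (wa h' 0) (rv h' rbest)) h.
Proof.
move=> [E em ew eR ec] eA; have e1 := env_one E; have ez := env_zero E.
apply: (@wp_conseq _ _ _ (tc (Seq (wcopy vlo vzero) (wcopy vb vone)) +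
  ((m * block_cost.+1).+1 + (tc (wcopy vk vone) + ((m * (tc copy_step).+1).+1 +
   tc (wadd vw vw vw)).+1).+1).+1).+1 _
   (fun h' => sinv (2 * w) cur0 h' /\
    forall t, done (2 * w) t (wa h' 0) (rv h' rbest))) => //.
  have h1 : (m * block_cost.+1 <= n * block_cost.+1)%N by rewrite leq_mul2r m_n orbT.
  have h2 : (m * (tc copy_step).+1 <= n * (tc copy_step).+1)%N by rewrite leq_mul2r m_n orbT.
  by rewrite /pass_cost; lia.
apply: wp_seq; rewrite -/(wpb W (Seq _ _) _ h).
apply: wpb_seq; apply: wpb_wcopy => //=; first by lia.
apply: wpb_wcopy => //=; first by lia.
apply: wp_seq.
set h1 := setwv _ vb _.
have I1 : binv m h1.
  split=> //=.
  - by split=> //=; do ?[apply: env_setwv => //].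
  - by rewrite e1 ez.
  - by rewrite ez subn0.
  - by exists 0%N => //=; rewrite ez; lia.
apply: (wp_conseq (leqnn _)) _ (wp_loop (b := ILe vb vm) (I := binv) (k := m)
   (Q := fun h => exists2 k, binv k h & (m < wv h vb)%N) _ _ _ I1) => //; last first.
- move=> k h2 I2 /= le; apply: wp_merge_block => //.
  by case: I2 le => -[_ em2 _ _ _] _ _ _ _; rewrite em2.
- move=> k h2 I2 /=; rewrite -ltnNge => lt; exists k => //.
  by case: I2 lt => -[_ em2 _ _ _] _ _ _ _; rewrite em2.
move=> h2 [k [[E2 em2 ew2 eR2 ec2] eA2 eb2 _ [t elo dn]] lt].
have e12 := env_one E2; have ez2 := env_zero E2.
have tm : (m <= t * (2 * w))%N by lia.
apply: wp_seq; rewrite -/(wpb W (wcopy _ _) _ h2).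
apply: wpb_wcopy => //=; first by lia.
apply: wp_seq; rewrite e12.
set h3 := setwv _ vk _.
have I3 : cinv (wa h2 1) (rv h2 rbest) m h3.
  split=> //=; last by move=> x; lia.
  - by split=> //=; apply: env_setwv.
  - by rewrite subn1.
apply: (wp_conseq (leqnn _)) _ (wp_copy I3).
move=> h4 [[E4 em4 ew4 eR4 ec4] er4 eA4].
rewrite -/(wpb W (wadd _ _ _) _ h4).
apply: wpb_warith => //=; first by rewrite ew4; lia.
split; first by split=> //=; [apply: env_setwv|rewrite ew4; lia].
move=> t' /=; rewrite er4.
case: (ltnP t' t) => tt'.
  by apply: block_done_trans (dn _ tt') => // x h1' h2'; rewrite eA4 //; lia.
have tt2 : (t * (2 * w) <= t' * (2 * w))%N by rewrite leq_mul2r tt' orbT.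
have e0 : (minn (t' * (2 * w) + 2 * w) m - t' * (2 * w) = 0)%N by lia.
by split=> [|x y|x y]; [rewrite /block e0|lia|lia].
Qed.

End Pass.

Definition sort_cost (L : nat) : nat :=
  (tc (wcopy vw vone) + (L.+1 * pass_cost.+1).+1 + 1)%N.

Lemma wp_merge_sort h L : (n <= 2 ^ L)%N -> env h -> wv h vm = m -> ra h = Ra ->
  wa h 0 = A0 ->
  wp W (merge_sort kc) (sort_cost L) (fun h' => [/\ env h', wv h' vm = m, ra h' = Ra,
     rv h' rbest <= rv h rbest & exists2 w, (m < w)%N &
       done w 0 (wa h' 0) (rv h' rbest)]) h.
Proof.
move=> nL E em eR eA; have e1 := env_one E; have ez := env_zero E.
apply: (@wp_conseq _ _ _ (tc (wcopy vw vone) + (L.+1 * pass_cost.+1).+1).+1 _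
  (fun h' => [/\ env h', wv h' vm = m, ra h' = Ra,
     rv h' rbest <= rv h rbest & exists2 w, (m < w)%N &
       done w 0 (wa h' 0) (rv h' rbest)])) => //.
  by rewrite /sort_cost; lia.
apply: wp_seq; rewrite -/(wpb W (wcopy _ _) _ h).
apply: wpb_wcopy => //=; first by lia.
pose I k h' := exists2 p, (k + p = L.+1)%N & sinv (2 ^ p) (rv h rbest) h' /\
  forall t, done (2 ^ p) t (wa h' 0) (rv h' rbest).
apply: (@wp_loop _ _ _ _ _ I) => //.
- move=> k h1 [p kp [[E1 em1 ew1 eR1 ec1] dn]] /=; rewrite ew1 em1 -ltnNge => lt.
  by split=> //; exists (2 ^ p)%N.
- move=> k h1 [p kp [[E1 em1 ew1 eR1 ec1] dn]] /=; rewrite ew1 em1 => le.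
  have pL : (p <= L)%N by rewrite -(leq_exp2l _ _ (isT : (1 < 2)%N)); lia.
  exists k.-1; first by lia.
  have -> : ((k - k.-1) * pass_cost = pass_cost)%N.
    by have -> : (k - k.-1 = 1)%N; [lia|rewrite mul1n].
  apply: (wp_conseq (leqnn _)) _ (@wp_sort_pass (2 ^ p) (wa h1 0) (rv h1 rbest) _ le dn
    h1 _ erefl).
  + move=> h2 [[E2 em2 ew2 eR2 ec2] dn2]; exists p.+1; first by lia.
    rewrite expnS; split=> //; split=> //; exact: le_trans ec2 ec1.
  + by rewrite expn_gt0.
  + by split.
- exists 0%N; first by rewrite addn0.
  split; first by split=> //=; apply: env_setwv.
  move=> t /=; rewrite eA; exact: block_done1.
Qed.

End Sort.

Definition linear_expr (g : coefs) : rexpr :=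
  rsum3 (fun c => RO RMul (RO RSub (RC (g (inord c)).1) (RC (g (inord c)).2))
                    (rcoord vi c)).

Definition key_expr (g : coefs) : rexpr := RO RDiv (linear_expr g) (RV rdot).

Definition add_valid (g1 g2 : coefs) : cmd :=
  Seq (wadd vm vm vone) (Seq (wstore 0 vm vi)
    (Seq (rstore 3 vi (RO RSub (RC 0) (key_expr g1)))
      (Seq (rstore 4 vi (key_expr g2))
        (rstore aS vi (RO RAdd (key_expr g1) (key_expr g2)))))).

Definition fill_step (u g1 g2 : coefs) : cmd :=
  Seq (rset rdot (linear_expr u))
    (Seq (If (RLe rdot rzero) (If (RLe rzero rdot) Skip (add_valid g1 g2))
            (add_valid g1 g2))
      (wadd vi vi vone)).

Definition fill (u g1 g2 : coefs) : cmd :=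
  Seq (Seq (wcopy vm vzero) (wcopy vi vone))
    (While (ILe vi vn) (fill_step u g1 g2)).

Definition chart (u g1 g2 : coefs) : cmd :=
  Seq (fill u g1 g2) (Seq (merge_sort 3) (merge_sort 4)).

Definition charts (N : nat) (xs : seq param) : cmd :=
  foldr (fun x c => Seq (chart (normal_coefs N x) (lower_coefs N x)
                           (upper_coefs N x)) c) Skip xs.

Section Charts.
Variables (R : realType) (W n : nat).
Hypothesis W_large : (1000 * n.+1 <= W)%N.
Variables (Y : nat -> R) (P : nat -> nat -> R).
Local Notation hst := (hst R).
Local Notation env := (env n Y P).
Local Notation pair_dist := (pair_dist Y P).
Local Notation pt := (pt Y P).

Let cellW := lt_cell W_large.

Lemma reval_linear_expr g h : env h ->
  reval (linear_expr g) h = dot (cvec R g) (pt (wv h vi)).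
Proof.
move=> E; have yE := env_y E; have PE := env_P E.
rewrite /dot !big_ord_recl !big_ord0 !mxE /= !PE //.
rewrite (yE 0%N) // (yE 1%N) // (yE 2%N) //.
have i0 : inord 0 = ord0 :> 'I_3 by apply: val_inj; rewrite /= inordK.
have i1 : inord 1 = lift ord0 ord0 :> 'I_3 by apply: val_inj; rewrite /= inordK.
have i2 : inord 2 = lift ord0 (lift ord0 ord0) :> 'I_3
  by apply: val_inj; rewrite /= inordK.
by rewrite i0 i1 i2 /= /bump /=; ring.
Qed.

Definition lits (g : coefs) : Prop :=
  forall i, ((g i).1 < W)%N /\ ((g i).2 < W)%N.

Lemma rsafe_linear_expr g (h : hst) : lits g -> (wv h vi <= n)%N ->
  rsafe W (linear_expr g) h.
Proof.
move=> lg le; have W33 : (33 < W)%N by lia.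
have l0 := lg (inord 0); have l1 := lg (inord 1); have l2 := lg (inord 2).
by rewrite /=; do ?split; try (by apply: cellW; lia); by [|case: l0|case: l1|case: l2].
Qed.

Section Chart.
Variables (u g1 g2 : coefs).
Hypotheses (lu : lits u) (lg1 : lits g1) (lg2 : lits g2).

Let U := cvec R u.
Let valid e := dot U (pt e) != 0.
Let k1 e := key U (cvec R g1) (pt e).
Let k2 e := key U (cvec R g2) (pt e).

Record finv (cur : R) (k : nat) (h : hst) : Prop := Finv {
  fi_env : env h; fi_cur : rv h rbest = cur;
  fi_i : (0 < wv h vi <= n.+1)%N; fi_k : k = (n.+1 - wv h vi)%N;
  fi_A : seg (wa h 0) 1 (wv h vm) = [seq e <- iota 1 (wv h vi).-1 | valid e];
  fi_key : forall e, (0 < e < wv h vi)%N -> valid e ->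
    [/\ ra h 3 e = - k1 e, ra h 4 e = k2 e & ra h aS e = k1 e + k2 e] }.

Lemma wpb_add_valid cur k h : finv cur k h -> (wv h vi <= n)%N ->
  rv h rdot = dot U (pt (wv h vi)) -> valid (wv h vi) ->
  wpb W (add_valid g1 g2) (fun h' => (wv h' vi <= n)%N /\
    finv cur k.-1 (setwv h' vi (wv h' vi).+1)) h.
Proof.
move=> [E ec /andP[i0 _] ek eA ekey] le ed val; have e1 := env_one E.
have mi : (wv h vm <= (wv h vi).-1)%N.
  have := congr1 size eA; rewrite size_map size_iota size_filter => ->.
  by apply: leq_trans (count_size _ _) _; rewrite size_iota.
apply: wpb_seq; apply: wpb_warith => //=; first by lia.
rewrite e1 addn1; apply: wpb_seq; apply: wpb_wstore => //=; first by apply: cellW; lia.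
set h1 := setwa _ 0 _ _.
have E1 : env h1 by do ?[apply: env_setwv => // | apply: env_setwa].
have W33 : (33 < W)%N by lia.
have s g : lits g -> rsafe W (key_expr g) h1.
  by move=> lg; split; first exact: rsafe_linear_expr.
have v g (h' : hst) : env h' -> wv h' vi = wv h vi -> rv h' rdot = rv h rdot ->
    reval (key_expr g) h' = key U (cvec R g) (pt (wv h vi)).
  move=> E' ei er; rewrite /key_expr; cbn [reval eval_rop].
  by rewrite reval_linear_expr // ei er ed.
apply: wpb_seq; apply: wpb_rstore => //; first by apply: cellW; rewrite //=; lia.
  by split; [rewrite /=; lia | exact: s].
set h2 := setra _ 3 _ _.
have E2 : env h2 by apply: env_setra.
apply: wpb_seq; apply: wpb_rstore => //; first by apply: cellW; rewrite //=; lia.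
  by split; first exact: rsafe_linear_expr.
set h3 := setra _ 4 _ _.
have E3 : env h3 by apply: env_setra.
apply: wpb_rstore => //; first by apply: cellW; rewrite //=; lia.
  by split; split=> //; exact: rsafe_linear_expr.
set h4 := setra _ 5 _ _.
have E4 : env h4 by apply: env_setra.
have er4 : ra h4 = upd2 (upd2 (upd2 (ra h) 3 (wv h vi) (- k1 (wv h vi)))
    4 (wv h vi) (k2 (wv h vi))) 5 (wv h vi) (k1 (wv h vi) + k2 (wv h vi)).
  rewrite /h4 /setra; cbn [ra]; congr upd2; last first.
    by cbn [reval eval_rop]; rewrite !v.
  rewrite /h3 /setra; cbn [ra]; congr upd2; last by rewrite v.
  rewrite /h2 /setra; cbn [ra]; congr upd2.
  by cbn [reval eval_rop]; rewrite v // sub0r.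
split; first exact: le.
split=> //.
- by apply: env_setwv.
- by rewrite /= ek subnS.
- rewrite [wv _ vm]/= [wv _ vi]/=.
  rewrite segS /= add1n eqxx.
  rewrite (@eq_seg _ (wa h 0)) => [|x hx]; last by rewrite /=; case: eqP => //; lia.
  have eio : iota 1 (wv h vi) = iota 1 (wv h vi).-1 ++ [:: wv h vi].
    by have := iotaD 1 (wv h vi).-1 1; rewrite addn1 prednK //= add1n prednK.
  by rewrite eio filter_cat -eA /= val cats1.
- rewrite -[ra (setwv h4 _ _)]/(ra h4) er4 [wv _ vi]/= => e he ve /=.
  case: eqP => [->//|ne]; apply: ekey => //; lia.
Qed.

Lemma wpb_fill_step cur k h : finv cur k h -> (wv h vi <= n)%N ->
  wpb W (fill_step u g1 g2) (finv cur k.-1) h.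
Proof.
move=> I le; have [E ec /andP[i0 _] ek eA ekey] := I; have e1 := env_one E.
have ez := env_rzero E; have W33 : (33 < W)%N by lia.
apply: wpb_seq; apply: wpb_rset => //; [by lia|exact: rsafe_linear_expr|].
rewrite reval_linear_expr //; set h1 := setrv _ _ _.
have E1 : env h1 by apply: env_setrv.
have I1 : finv cur k h1 by split=> //; exact: fi_i I.
apply: wpb_seq.
have fin h' : (wv h' vi <= n)%N /\ finv cur k.-1 (setwv h' vi (wv h' vi).+1) ->
    wpb W (wadd vi vi vone) (finv cur k.-1) h'.
  move=> [en' I']; have e1' : wv h' vone = 1%N := env_one (fi_env I').
  by apply: wpb_warith => //=; rewrite e1' addn1 //; lia.
have add : valid (wv h vi) -> wpb W (add_valid g1 g2)
    (wpb W (wadd vi vi vone) (finv cur k.-1)) h1.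
  move=> v; apply: (wp_conseq (leqnn _) fin).
  exact: wpb_add_valid.
apply: wpb_if => //= l1.
  apply: wpb_if => //= l2.
    apply: wpb_skip; apply: fin; split; [exact: le|split=> //].
    - by apply: env_setwv.
    - by rewrite /= ek subnS.
    - rewrite [wv _ vi]/= [wv _ vm]/= [wa _]/= eA.
      have eio : iota 1 (wv h vi).+1.-1 = iota 1 (wv h vi).-1 ++ [:: wv h vi].
        by have := iotaD 1 (wv h vi).-1 1; rewrite addn1 prednK //= add1n prednK.
      rewrite eio filter_cat /= /valid.
      have -> : dot U (pt (wv h vi)) = 0 by rewrite ez in l1 l2; apply/eqP; rewrite eq_le l1.
      by rewrite eqxx cats0.
    - rewrite [wv _ vi]/= => e he ve; apply: ekey => //.
      have [ee|] := eqVneq e (wv h vi); last by lia.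
      move: ve; rewrite /valid ee; rewrite ez in l1 l2.
      by rewrite (_ : dot _ _ = 0) ?eqxx //; apply/eqP; rewrite eq_le l1.
  by apply: add; rewrite /valid; apply: contraNneq l2; rewrite ez => ->.
by apply: add; rewrite /valid; apply: contraNneq l1; rewrite ez => ->.
Qed.

Definition fill_cost : nat :=
  (tc (Seq (wcopy vm vzero) (wcopy vi vone)) +
   (n * (tc (fill_step u g1 g2)).+1).+1 + 1)%N.

Lemma wp_fill h : env h -> wp W (fill u g1 g2) fill_cost (fun h' =>
  [/\ env h', rv h' rbest = rv h rbest,
     seg (wa h' 0) 1 (wv h' vm) = [seq e <- iota 1 n | valid e] &
     forall e, (0 < e <= n)%N -> valid e ->
       [/\ ra h' 3 e = - k1 e, ra h' 4 e = k2 e & ra h' aS e = k1 e + k2 e]]) h.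
Proof.
move=> E; have ez := env_zero E; have e1 := env_one E.
rewrite /fill_cost addn1.
apply: wp_seq; rewrite -/(wpb W (Seq _ _) _ h).
apply: wpb_seq; apply: wpb_wcopy => //=; first by lia.
apply: wpb_wcopy => //=; first by lia.
rewrite ez e1; set h1 := setwv _ vi _.
have I1 : finv (rv h rbest) n h1.
  split=> //=; last by move=> e; lia.
  - by do ?[apply: env_setwv => //].
  - by lia.
apply: (@wp_loop _ _ _ _ _ (finv (rv h rbest))) I1 => // k h2 I2 /=.
  case: I2 => E2 ec2 i2 _ eA2 ekey2; rewrite (env_n E2) -ltnNge => lt.
  have ei : wv h2 vi = n.+1 by lia.
  rewrite ei /= in eA2 ekey2; split=> // e he; exact: ekey2.
rewrite (env_n (fi_env I2)) => le; have ek := fi_k I2.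
exists k.-1; first by lia.
have -> : (k - k.-1 = 1)%N by lia.
by rewrite mul1n; exact: wpb_fill_step.
Qed.

Definition chart_cost (L : nat) : nat :=
  (fill_cost + (sort_cost n 3 L + sort_cost n 4 L).+1).+1.

Lemma wp_chart h L : (n <= 2 ^ L)%N -> env h ->
  wp W (chart u g1 g2) (chart_cost L) (fun h' =>
    [/\ env h', rv h' rbest <= rv h rbest &
       dominated_pairs n valid k1 k2 (fun a c => rv h' rbest <= pair_dist a c)]) h.
Proof.
move=> nL E; apply: wp_seq; apply: (wp_conseq (leqnn _)) _ (wp_fill E).
move=> h1 [E1 ec1 eA1 ekey1].
pose m := wv h1 vm.
have m_n : (m <= n)%N.
  have := congr1 size eA1; rewrite size_map size_iota size_filter /m => ->.
  by apply: leq_trans (count_size _ _) _; rewrite size_iota.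
have memA v : (v \in seg (wa h1 0) 1 m) = ((0 < v <= n)%N && valid v).
  by rewrite eA1 mem_filter mem_iota andbC add1n.
have uniqA : uniq (seg (wa h1 0) 1 m) by rewrite eA1 filter_uniq // iota_uniq.
have rangeA x : (0 < x <= m)%N -> (0 < wa h1 0 x <= n)%N.
  move=> hx; have : wa h1 0 x \in seg (wa h1 0) 1 m by apply/segP; exists x => //; lia.
  by rewrite memA => /andP[].
apply: wp_seq.
apply: (wp_conseq (leqnn _)) _ (wp_merge_sort W_large (isT : (3 < 8)%N) m_n uniqA rangeA
  nL E1 erefl erefl erefl).
move=> h2 [E2 em2 eR2 le2 [w mw [p2 s2 _]]].
have e0 : (minn (0 * w + w) m - 0 * w = m)%N by lia.
rewrite /block e0 mul0n in p2 s2.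
have memA2 v : (v \in seg (wa h2 0) 1 m) = ((0 < v <= n)%N && valid v).
  by rewrite (perm_mem p2) memA.
have rangeA2 z : (0 < z <= m)%N -> (0 < wa h2 0 z <= n)%N && valid (wa h2 0 z).
  by move=> hz; rewrite -memA2; apply/segP; exists z => //; lia.
have keyA2 z : (0 < z <= m)%N -> [/\ ra h1 3 (wa h2 0 z) = - k1 (wa h2 0 z),
    ra h1 4 (wa h2 0 z) = k2 (wa h2 0 z) &
    ra h1 aS (wa h2 0 z) = k1 (wa h2 0 z) + k2 (wa h2 0 z)].
  by move=> /rangeA2/andP[hz vz]; exact: ekey1.
have {}s2 x y : (0 < x)%N -> (x < y <= m)%N -> k1 (wa h2 0 x) <= k1 (wa h2 0 y).
  move=> x0 /andP[xy ym]; have [|kx _ _] := keyA2 x; first by lia.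
  have [|ky _ _] := keyA2 y; first by lia.
  have := s2 x y x0 xy; rewrite add0n kx ky lerN2; apply; lia.
have uniqA2 : uniq (seg (wa h2 0) 1 m) by rewrite (perm_uniq p2).
have rangeA2' z : (0 < z <= m)%N -> (0 < wa h2 0 z <= n)%N.
  by move=> /rangeA2/andP[].
apply: (wp_conseq (leqnn _)) _ (wp_merge_sort W_large (isT : (4 < 8)%N) m_n uniqA2
  rangeA2' nL E2 em2 eR2 erefl).
move=> h3 [E3 _ _ le3 [w' mw' [_ _ f3]]]; split=> //.
  by rewrite -ec1; exact: le_trans le3 le2.
have edge x y : (0 < x)%N -> (x < y <= m)%N -> k2 (wa h2 0 x) <= k2 (wa h2 0 y) ->
    exists c, [/\ (0 < c <= n)%N && valid c, c != wa h2 0 x,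
      k1 (wa h2 0 x) <= k1 c /\ k2 (wa h2 0 x) <= k2 c,
      k1 c + k2 c <= k1 (wa h2 0 y) + k2 (wa h2 0 y) &
      rv h3 rbest <= pair_dist (wa h2 0 x) c].
  move=> x0 /andP[xy ym] le.
  have [|_ kx _] := keyA2 x; first by lia.
  have [|_ ky sy] := keyA2 y; first by lia.
  have [|||z [hz k4 s4 d4]] := f3 x y _ xy; [by lia|by lia|by rewrite kx ky|].
  have z0 : (0 < z <= m)%N by move: hz; clear; lia.
  have [_ kz sz] := keyA2 z z0.
  exists (wa h2 0 z); split=> //.
  - exact: rangeA2.
  - apply/eqP => e; have zx : z = x.
      by apply: uniq_seg_inj uniqA2 _ _ e; [move: z0|move: x0 xy ym]; clear; lia.
    by move: hz; rewrite zx ltnn.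
  - by split; [exact: s2|rewrite -kx -kz].
  - by rewrite -sz -sy.
move=> a b ha hb va' vb' ab.
have /segP[x hx ex] : a \in seg (wa h2 0) 1 m by rewrite memA2 ha.
have /segP[y hy ey] : b \in seg (wa h2 0) 1 m by rewrite memA2 hb.
have xy : x != y by apply: contraNneq ab => e; rewrite ex ey e.
have {hx} [x0 xm] : (0 < x)%N /\ (x <= m)%N by move: hx; clear; lia.
have {hy} [y0 ym] : (0 < y)%N /\ (y <= m)%N by move: hy; clear; lia.
split=> [l1 l2|e1 e2].
  have [lt|lt|e] := ltngtP x y; last by rewrite e eqxx in xy.
    by rewrite ex ey; apply: edge; rewrite ?lt // -ex -ey.
  have : k1 b <= k1 a by rewrite ex ey; apply: s2; rewrite ?lt.
  by rewrite leNgt l1.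
have [lt|lt|e] := ltngtP x y; last by rewrite e eqxx in xy.
  by left; rewrite ex ey; apply: edge; rewrite ?lt // -ex -ey e2.
by right; rewrite ex ey; apply: edge; rewrite ?lt // -ex -ey e2.
Qed.

End Chart.
End Charts.

Definition init : cmd :=
  Seq (Do (IConst vone 1)) (Seq (Do (IConst vzero 0)) (Seq (rset rzero (RC 0))
    (Seq (wadd vx vn vone) (Seq (rset 8 (RA 0 vx)) (Seq (rset 9 (RA 1 vx))
      (Seq (rset 10 (RA 2 vx)) (Seq (wcopy vbi vone) (Seq (wadd vbj vone vone)
        (Seq (wcopy va vone) (Seq (wadd vc vone vone)
          (rset rbest sqr_line_dist_expr))))))))))).

(* A line through a point p with u . p = 0 meets the plane u . x = 0 at p, and
   every line through p is at distance at most |p|: one pair per p suffices. *)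
Definition near_step : cmd :=
  Seq (wcopy va vi) (Seq eval_pair (wadd vi vi vone)).

Definition near : cmd :=
  Seq (Seq (wcopy vc vone) (wadd vi vone vone)) (While (ILe vi vn) near_step).

Definition output : cmd :=
  Seq (rset 0 (RA 0 vbi)) (Seq (rset 1 (RA 1 vbi)) (Seq (rset 2 (RA 2 vbi))
    (Seq (rset 3 (RA 0 vbj)) (Seq (rset 4 (RA 1 vbj)) (rset 5 (RA 2 vbj)))))).

Definition solve (N : nat) : cmd :=
  Seq init (Seq near (Seq (charts N (params N)) output)).

Lemma dominated_pairs_mono (R : realType) n ok (k1 k2 : nat -> R)
    (good good' : nat -> nat -> Prop) :
  (forall a c, good a c -> good' a c) ->
  dominated_pairs n ok k1 k2 good -> dominated_pairs n ok k1 k2 good'.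
Proof.
move=> H dom edge a b ha hb oka okb ab; rewrite {}/edge; have [d1 d2] := dom a b ha hb oka okb ab.
split=> [l1 l2|l1 l2]; first by have [c [? ? ? ? /H ?]] := d1 l1 l2; exists c.
by case: (d2 l1 l2) => -[c [? ? ? ? /H ?]]; [left|right]; exists c.
Qed.

Section Solve.
Variables (R : realType) (W n N : nat).
Hypotheses (W_large : (1000 * n.+1 <= W)%N) (N_W : (2 * N + 1 < W)%N).
Hypothesis n2 : (2 <= n)%N.
Variables (Y : nat -> R) (P : nat -> nat -> R).
Local Notation hst := (hst R).
Local Notation env := (env n Y P).
Local Notation pair_dist := (pair_dist Y P).
Local Notation pt := (pt Y P).

Let cellW := lt_cell W_large.

Definition chart_ok (d : R) (x : param) : Prop :=
  let u := cvec R (normal_coefs N x) in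
  dominated_pairs n (fun a => dot u (pt a) != 0)
    (fun a => key u (cvec R (lower_coefs N x)) (pt a))
    (fun a => key u (cvec R (upper_coefs N x)) (pt a))
    (fun a c => d <= pair_dist a c).

Lemma chart_ok_mono d d' x : d' <= d -> chart_ok d x -> chart_ok d' x.
Proof. by move=> le; apply: dominated_pairs_mono => a c; exact: le_trans. Qed.

Definition charts_cost (L : nat) (xs : seq param) : nat :=
  foldr (fun x t => (chart_cost n (normal_coefs N x) (lower_coefs N x)
                       (upper_coefs N x) L + t).+1) 1%N xs.

Lemma wp_charts L xs h : (n <= 2 ^ L)%N -> {subset xs <= params N} -> env h ->
  wp W (charts N xs) (charts_cost L xs) (fun h' => [/\ env h',
    rv h' rbest <= rv h rbest & forall x, x \in xs -> chart_ok (rv h' rbest) x]) h.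
Proof.
move=> nL; elim: xs h => [|x xs IH] h sub E.
  by apply: wpb_skip; split.
have xN : x \in params N by apply: sub; rewrite mem_head.
have l1 : lits W (normal_coefs N x).
  by move=> i; have [] := lit_params i xN; lia.
have l2 : lits W (lower_coefs N x).
  by move=> i; have [] := lit_params i xN; lia.
have l3 : lits W (upper_coefs N x).
  by move=> i; have [_ _ _ _ []] := lit_params i xN; lia.
apply: wp_seq; apply: (wp_conseq (leqnn _)) _ (wp_chart W_large l1 l2 l3 nL E).
move=> h1 [E1 le1 dom1].
apply: (wp_conseq (leqnn _)) _ (IH h1 _ E1).
  move=> h2 [E2 le2 dom2]; split=> //; first exact: le_trans le1.
  move=> y; rewrite inE => /orP[/eqP->|/dom2 //].
  exact: (chart_ok_mono (d := rv h1 rbest)).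
by move=> y hy; apply: sub; rewrite inE hy orbT.
Qed.

Lemma wp_init h : wv h vn = n -> (forall c, (c < 3)%N -> Y c = ra h c n.+1) ->
  (forall c e, (c < 3)%N -> P c e = ra h c e) ->
  wpb W init (fun h' => env h' /\ rv h' rbest = pair_dist 1 2) h.
Proof.
move=> en yE PE.
apply: wpb_seq; apply: wpb_wconst => //; first by lia.
apply: wpb_seq; apply: wpb_wconst => //; first by lia.
apply: wpb_seq; apply: wpb_rset => //; [by lia|by rewrite /=; lia|].
apply: wpb_seq; apply: wpb_warith => //=; first by rewrite en; lia.
rewrite en addn1.
apply: wpb_seq; apply: wpb_rset => //; [by lia|by apply: cellW; rewrite /=|].
apply: wpb_seq; apply: wpb_rset => //; [by lia|by apply: cellW; rewrite /=|].
apply: wpb_seq; apply: wpb_rset => //; [by lia|by apply: cellW; rewrite /=|].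
apply: wpb_seq; apply: wpb_wcopy => //=; first by lia.
apply: wpb_seq; apply: wpb_warith => //=; first by lia.
apply: wpb_seq; apply: wpb_wcopy => //=; first by lia.
apply: wpb_seq; apply: wpb_warith => //=; first by lia.
set h1 := setwv _ vc _.
have y1 c : (c < 3)%N -> rv h1 (ry + c) = Y c.
  by move=> lt; rewrite yE //; case: c lt => [|[|[|]]].
have P1 c e : (c < 3)%N -> ra h1 c e = P c e by move=> lt; rewrite PE.
apply: wpb_rset => //; first by lia.
  by rewrite /=; do ?split; try (by apply: cellW); lia.
rewrite (reval_sqr_line_dist y1 P1) /=; split=> //.
by split=> //=; exact: ltnW.
Qed.

Record ninv (k : nat) (h : hst) : Prop := Ninv {
  ni_env : env h; ni_c : wv h vc = 1%N; ni_i : (1 < wv h vi <= n.+1)%N;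
  ni_k : k = (n.+1 - wv h vi)%N; ni_12 : rv h rbest <= pair_dist 1 2;
  ni_near : forall e, (1 < e < wv h vi)%N -> rv h rbest <= pair_dist e 1 }.

Definition near_cost : nat :=
  (tc (Seq (wcopy vc vone) (wadd vi vone vone)) + (n * (tc near_step).+1).+1).+1.

Lemma wp_near h : env h -> rv h rbest = pair_dist 1 2 ->
  wp W near near_cost (fun h' => env h' /\ forall e, (0 < e <= n)%N ->
    exists f, [/\ (0 < f <= n)%N, f != e & rv h' rbest <= pair_dist e f]) h.
Proof.
move=> E e12; have e1 := env_one E; have ez := env_zero E; have en := env_n E.
apply: wp_seq; rewrite -/(wpb W (Seq _ _) _ h).
apply: wpb_seq; apply: wpb_wcopy => //=; first by lia.
apply: wpb_warith => //=; first by lia.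
rewrite e1; set h1 := setwv _ vi _.
have I1 : ninv n.-1 h1.
  split=> //=; try lia.
  - by do ?[apply: env_setwv => //].
  - by rewrite e12.
apply: (@wp_conseq _ _ _ (n.-1 * (tc near_step).+1).+1 _ (fun h' => exists2 k, ninv k h' & (n < wv h' vi)%N)).
- by rewrite ltnS leq_mul2r leq_pred orbT.
- move=> h2 [k [E2 ec2 i2 _ d12 dn] lt]; split=> // e he.
  have [->|ne] := eqVneq e 1%N; first by exists 2%N.
  by exists 1%N; split; [lia|rewrite eq_sym|apply: dn; lia].
apply: (@wp_loop _ _ _ _ _ ninv) I1 => // k h2 I2 /=; rewrite (env_n (ni_env I2)).
  by rewrite -ltnNge => lt; exists k.
move=> le; have [E2 ec2 i2 ek d12 dn] := I2; exists k.-1; first by lia.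
have -> : (k - k.-1 = 1)%N by lia.
rewrite mul1n -/(wpb W near_step _ h2); have [e12' ez2] := (env_one E2, env_zero E2).
apply: wpb_seq; apply: wpb_wcopy => //=; first by lia.
apply: wpb_seq; apply: (@wpb_eval_pair _ _ n W_large Y P) => //=.
- by do ?[apply: env_setwv => //].
- by lia.
- by lia.
- by rewrite ec2; lia.
move=> h3 E3 f1 f2 f3 le3 d3; have e13 := env_one E3.
have ei : wv h3 vi = wv h2 vi by rewrite f1.
have ec3 : wv h3 vc = 1%N by rewrite f1.
apply: wpb_warith => //=; first by lia.
rewrite ei e13 addn1; split=> //=.
- by do ?[apply: env_setwv => //].
- by lia.
- by rewrite ek subnS.
- exact: le_trans le3 d12.
- move=> e he; have [->|ne] := eqVneq e (wv h2 vi); first by move: d3; rewrite ec2.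
  by apply: le_trans le3 _; apply: dn; lia.
Qed.

Definition solve_cost (L : nat) : nat :=
  (tc init + (near_cost + (charts_cost L (params N) + tc output).+1).+1).+1.

Lemma wp_solve L h : (n <= 2 ^ L)%N -> wv h vn = n ->
  (forall c, (c < 3)%N -> Y c = ra h c n.+1) ->
  (forall c e, (c < 3)%N -> P c e = ra h c e) ->
  wp W (solve N) (solve_cost L) (fun h' => exists a b,
    [/\ [/\ (0 < a <= n)%N, (0 < b <= n)%N & a != b],
       forall c, (c < 3)%N -> rv h' c = P c a /\ rv h' (3 + c) = P c b,
       forall e, (0 < e <= n)%N -> exists f,
         [/\ (0 < f <= n)%N, f != e & pair_dist a b <= pair_dist e f] &
       forall x, x \in params N -> chart_ok (pair_dist a b) x]) h.
Proof.
move=> nL en yE PE; apply: wp_seq; rewrite -/(wpb W init _ h).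
apply: (wp_conseq (leqnn _)) _ (wp_init en yE PE) => h1 [E1 d12].
apply: wp_seq; apply: (wp_conseq (leqnn _)) _ (wp_near E1 d12) => h2 [E2 near2].
apply: wp_seq; apply: (wp_conseq (leqnn _)) _ (wp_charts nL _ E2) => // h3 [E3 le3 ok3].
have [[ha hb] ab] := (env_bi E3, env_bj E3, env_bij E3).
have P3 := env_P E3; have best := env_best E3.
rewrite -/(wpb W output _ h3).
do 5!(apply: wpb_seq; apply: wpb_rset => //=; [by lia|by apply: cellW; lia|]).
apply: wpb_rset => //=; [by lia|by apply: cellW; lia|].
exists (wv h3 vbi), (wv h3 vbj); split=> //.
- move=> [|[|[|//]]] _ /=; by rewrite !P3.
- move=> e he; have [f [hf fe le]] := near2 e he; exists f; split=> //.
  by rewrite -best; apply: le_trans le.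
- by move=> x xN; rewrite -best; exact: ok3.
Qed.

End Solve.

(** * Moving the input, and running time *)

Definition move_real : cmd :=
  Seq (Do (RLoad 0 3)) (Seq (Do (RStore 4 0))
    (Seq (Do (IArith IAdd 3 3 1)) (Do (IArith IAdd 4 4 1)))).

Definition move_step : cmd :=
  Seq (Do (IConst 3 64)) (Seq (Do (IArith IMul 4 2 5))
    (Seq (Do (IArith IAdd 4 4 3)) (Seq (Do (IConst 3 3))
      (Seq (Do (IArith IMul 3 3 5)) (Seq move_real (Seq move_real
        (Seq move_real (Do (IArith ISub 5 5 1))))))))).

Definition save_y : cmd :=
  Seq (Do (IConst 1 1)) (Seq (Do (IConst 2 8)) (Seq (Do (IArith IAdd 5 0 1))
    (Seq (Do (IArith IMul 4 2 5)) (Seq (Do (IConst 3 64))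
      (Seq (Do (IArith IAdd 4 4 3)) (Seq (Do (RStore 4 0))
        (Seq (Do (IArith IAdd 4 4 1)) (Seq (Do (RStore 4 1))
          (Seq (Do (IArith IAdd 4 4 1)) (Seq (Do (RStore 4 2))
            (Do (IArith ISub 5 5 1)))))))))))).

(* The entries are moved in decreasing order, so that no entry is overwritten
   before it is read. *)
Definition prologue : cmd := Seq save_y (While (ILe 1 5) move_step).

Definition program (N : nat) : cmd := Seq prologue (solve N).

Section Prologue.
Variables (R : realType) (W n : nat).
Hypothesis W_large : (1000 * n.+1 <= W)%N.
Variable inp : nat -> R.
Local Notation mem := (Defs.mem R).

Lemma wpm_seqb c1 c2 (Q : mem -> Prop) m :
  wpm W c1 (tc c1) (wpm W c2 (tc c2) Q) m ->
  wpm W (Seq c1 c2) (tc (Seq c1 c2)) Q m.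
Proof. exact: wpm_seq. Qed.

Lemma wpm_iconst d k (Q : mem -> Prop) m : (k < W)%N -> Q (setw m d k) ->
  wpm W (Do (IConst d k)) (tc (Do (IConst d k))) Q m.
Proof. by move=> kW q; apply: wpm_do q; rewrite /= kW. Qed.

Lemma wpm_iarith o d x y (Q : mem -> Prop) m :
  (eval_iop o (word m x) (word m y) < W)%N ->
  Q (setw m d (eval_iop o (word m x) (word m y))) ->
  wpm W (Do (IArith o d x y)) (tc (Do (IArith o d x y))) Q m.
Proof. by move=> kW q; apply: wpm_do q; rewrite /= kW. Qed.

Lemma wpm_rstore d a (Q : mem -> Prop) m :
  Q (setr m (word m d) (real m a)) ->
  wpm W (Do (RStore d a)) (tc (Do (RStore d a))) Q m.
Proof. by move=> q; apply: wpm_do q. Qed.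

Lemma wpm_move_real (Q : mem -> Prop) m : word m 1 = 1%N ->
  ((word m 3).+1 < W)%N -> ((word m 4).+1 < W)%N ->
  Q (Defs.Mem (upd (upd (word m) 3 (word m 3).+1) 4 (word m 4).+1)
       (upd (upd (real m) 0 (real m (word m 3))) (word m 4) (real m (word m 3)))) ->
  wpm W move_real (tc move_real) Q m.
Proof.
move=> e1 h3 h4 q; apply: wpm_seqb; apply: wpm_do; first by [].
apply: wpm_seqb; apply: wpm_rstore; apply: wpm_seqb.
apply: wpm_iarith; first by rewrite /= e1 addn1.
by apply: wpm_iarith; rewrite /= e1 ?addn1.
Qed.

Record pinv (k : nat) (m : mem) : Prop := Pinv {
  pi_n : word m 0 = n; pi_1 : word m 1 = 1%N; pi_8 : word m 2 = 8%N;
  pi_k : word m 5 = k; pi_kn : (k <= n)%N;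
  pi_y : forall c, (c < 3)%N -> real m (cell c n.+1) = inp c;
  pi_moved : forall e c, (k < e <= n)%N -> (c < 3)%N ->
    real m (cell c e) = inp (3 * e + c)%N;
  pi_unmoved : forall x, (3 <= x < 3 * k + 3)%N -> real m x = inp x }.

Lemma wpm_save_y m : word m 0 = n -> real m =1 inp ->
  wpm W save_y (tc save_y) (pinv n) m.
Proof.
move=> en er.
apply: wpm_seqb; apply: wpm_iconst; first by lia.
apply: wpm_seqb; apply: wpm_iconst; first by lia.
apply: wpm_seqb; apply: wpm_iarith => /=; first by lia.
rewrite en addn1; apply: wpm_seqb; apply: wpm_iarith => /=; first by lia.
apply: wpm_seqb; apply: wpm_iconst; first by lia.
apply: wpm_seqb; apply: wpm_iarith => /=; first by lia.
apply: wpm_seqb; apply: wpm_rstore => /=.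
apply: wpm_seqb; apply: wpm_iarith => /=; first by lia.
apply: wpm_seqb; apply: wpm_rstore => /=.
apply: wpm_seqb; apply: wpm_iarith => /=; first by lia.
apply: wpm_seqb; apply: wpm_rstore => /=.
apply: wpm_iarith => /=; first by lia.
split=> //=; rewrite /cell.
- by lia.
- move=> [|[|[|//]]] _ /=; rewrite !er; repeat (case: eqP => ?);
    by first [done | exfalso; lia].
- by move=> e c; lia.
- move=> x hx; rewrite !er; repeat (case: eqP => ?);
    by first [done | exfalso; lia].
Qed.

Lemma wpm_move_step k m : pinv k m -> (0 < k)%N ->
  wpm W move_step (tc move_step) (pinv k.-1) m.
Proof.
case=> en e1 e8 ek kn py pm pu k0.
apply: wpm_seqb; apply: wpm_iconst; first by lia.
apply: wpm_seqb; apply: wpm_iarith => /=; first by rewrite e8 ek; lia.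
apply: wpm_seqb; apply: wpm_iarith => /=; first by rewrite e8 ek; lia.
rewrite e8 ek.
apply: wpm_seqb; apply: wpm_iconst; first by lia.
apply: wpm_seqb; apply: wpm_iarith => /=; first by rewrite ek; lia.
rewrite ek.
apply: wpm_seqb; apply: wpm_move_real => //=; [by lia|by lia|].
apply: wpm_seqb; apply: wpm_move_real => //=; [by lia|by lia|].
apply: wpm_seqb; apply: wpm_move_real => //=; [by lia|by lia|].
apply: wpm_iarith => /=; first by lia.
have v0 : real m (3 * k) = inp (3 * k)%N by apply: pu; lia.
have v1 : real m (3 * k).+1 = inp (3 * k).+1 by apply: pu; lia.
have v2 : real m (3 * k).+2 = inp (3 * k).+2 by apply: pu; lia.
rewrite (_ : ((3 * k).+1 == 8 * k + 64)%N = false); last by lia.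
rewrite (_ : ((3 * k).+2 == 8 * k + 64)%N = false); last by lia.
rewrite (_ : ((3 * k).+2 == (8 * k + 64).+1)%N = false); last by lia.
rewrite v0 v1 v2.
split=> //=; rewrite /cell.
- by rewrite ek e1 subn1.
- by lia.
- move=> c c3; repeat (case: eqP => ?); first [exact: py | exfalso; lia].
- move=> e c he c3; have [->|ne] := eqVneq e k.
    case: c c3 => [|[|[|//]]] _; rewrite ?addn0 ?addn1 ?addn2;
    by repeat (case: eqP => ?); first [done | exfalso; lia].
  by repeat (case: eqP => ?); first [apply: pm => //; lia | exfalso; lia].
- move=> x hx; repeat (case: eqP => ?); first [apply: pu; lia | exfalso; lia].
Qed.

Definition prologue_cost : nat := (tc save_y + (n * (tc move_step).+1).+1).+1.

Lemma wpm_prologue m : word m 0 = n -> real m =1 inp ->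
  wpm W prologue prologue_cost (pinv 0) m.
Proof.
move=> en er; apply: wpm_seq.
apply: (wpm_conseq (leqnn _)) _ (wpm_save_y en er) => m1 I1.
apply: (wpm_loop (I := pinv)) I1 => k m2 I2 /=; rewrite (pi_1 I2) (pi_k I2).
  by rewrite -ltnNge ltnS leqn0 => /eqP <-.
move=> k0; exists k.-1; first by lia.
have -> : (k - k.-1 = 1)%N by lia.
by rewrite mul1n; exact: wpm_move_step.
Qed.

Lemma abs_prologue m : pinv 0 m -> [/\ wv (abs m) vn = n,
  forall c, (c < 3)%N -> ra (abs m) c n.+1 = inp c &
  forall e c, (0 < e <= n)%N -> (c < 3)%N -> ra (abs m) c e = inp (3 * e + c)%N].
Proof.
case=> en _ _ _ _ py pm _; split=> //= [c c3|e c he c3].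
  by rewrite (leq_trans c3) // py.
by rewrite (leq_trans c3) // pm.
Qed.

End Prologue.

Definition linear_cost (f : nat -> nat) : Prop :=
  exists C, forall n, (f n <= C * n.+1)%N.

Definition quasilinear_cost (f : nat -> nat -> nat) : Prop :=
  exists C, forall n L, (f n L <= C * (n.+1 * L.+1))%N.

Lemma linear_cost_loop a c b f : (forall n, f n = (a + (n * c).+1 + b)%N) ->
  linear_cost f.
Proof. by move=> E; exists (a + c + b + 1)%N => n; rewrite E; nia. Qed.

Lemma linear_pass_cost kc : linear_cost (fun n => pass_cost n kc).
Proof.
rewrite /pass_cost; move: (tc _) (tc _) (tc _) (tc _) (block_cost kc) => a b c d e.
by exists (a + b + c + d + e + 8)%N => n; nia.
Qed.

Lemma quasilinear_linear f : linear_cost f -> quasilinear_cost (fun n _ => f n).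
Proof.
move=> [C H]; exists C => n L; apply: leq_trans (H n) _.
by rewrite leq_mul2l -[X in (X <= _)%N]muln1 leq_mul2l !orbT.
Qed.

Lemma quasilinear_add f g : quasilinear_cost f -> quasilinear_cost g ->
  quasilinear_cost (fun n L => (f n L + g n L).+1).
Proof.
move=> [C H] [C' H']; exists (C + C' + 1)%N => n L.
have := H n L; have := H' n L; move: (f n L) (g n L) => x y h1 h2.
have : (0 < n.+1 * L.+1)%N by [].
by move: (n.+1 * L.+1)%N h1 h2 => z; nia.
Qed.

Lemma quasilinear_sort_cost kc : quasilinear_cost (fun n L => sort_cost n kc L).
Proof.
have [C H] := linear_pass_cost kc; exists (tc (wcopy vw vone) + C + 3)%N => n L.
rewrite /sort_cost; move: (tc _) => a.
have h1 : (L.+1 * (pass_cost n kc).+1 <= L.+1 * (C * n.+1).+1)%N.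
  by rewrite leq_mul2l ltnS H orbT.
have h2 : (L.+1 * (C * n.+1).+1 <= C.+1 * (n.+1 * L.+1))%N by nia.
have : (0 < n.+1 * L.+1)%N by [].
by move: (n.+1 * L.+1)%N h2 => z; nia.
Qed.

Lemma quasilinear_charts_cost N xs :
  quasilinear_cost (fun n L => charts_cost n N L xs).
Proof.
elim: xs => [|x xs IH]; first by exists 1%N.
apply: quasilinear_add IH; apply: quasilinear_add.
  apply: quasilinear_linear; rewrite /fill_cost.
  exact: linear_cost_loop.
by apply: quasilinear_add; exact: quasilinear_sort_cost.
Qed.

Definition program_cost (N n L : nat) : nat :=
  (prologue_cost n + solve_cost n N L).+1.

Lemma quasilinear_program_cost N : quasilinear_cost (program_cost N).
Proof.
apply: quasilinear_add.
  apply: quasilinear_linear; apply: (@linear_cost_loop (tc save_y) _ 1) => n.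
  by rewrite /prologue_cost addn1.
apply: (quasilinear_add (f := fun _ _ => tc init)); first by exists (tc init) => n L; nia.
apply: quasilinear_add.
  apply: quasilinear_linear.
  apply: (@linear_cost_loop (tc (Seq (wcopy vc vone) (wadd vi vone vone))) _ 1) => n.
  by rewrite /near_cost addn1.
apply: (quasilinear_add (g := fun _ _ => tc output)); first exact: quasilinear_charts_cost.
by exists (tc output) => n L; nia.
Qed.

Lemma quasilinear_ln (R : realType) C n : (2 <= n)%N ->
  (C * (n.+1 * (up_log 2 n).+1))%:R <=
    C%:R * (6 / ln (2 : R) ^+ 3) * (n%:R * ln (n%:R : R) ^+ 3).
Proof.
move=> n2; have ln2 : 0 < ln (2 : R) by rewrite ln_gt0 // ltr1n.
have n0 : 0 < (n%:R : R) by rewrite ltr0n; lia.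
have ln2n : ln (2 : R) <= ln (n%:R : R).
  by rewrite ler_ln ?posrE // ler_nat.
have /andP[up _] := up_log_bounds (isT : (1 < 2)%N) n2.
set L := up_log 2 n in up *.
have L0 : (0 < L)%N by rewrite /L up_log_gt0 // ltnW.
have {up}hL : ln (2 : R) * L.-1%:R <= ln (n%:R : R).
  rewrite mulr_natr -lnXn // ler_ln ?posrE ?exprn_gt0 //.
  by rewrite -natrX ler_nat ltnW.
have eL : (L.+1%:R : R) = L.-1%:R + 2 by rewrite -{1}(prednK L0) -!natr1; ring.
rewrite natrM natrM -[leRHS]mulrA; apply: ler_wpM2l => //; rewrite eL.
have n1 : (n.+1%:R : R) <= 2 * n%:R by rewrite -natr1; have : 1 <= (n%:R : R); 
  [rewrite ler1n; lia|lra].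
move: (ln (2 : R)) (ln (n%:R : R)) ln2 ln2n hL => q l q0 ql hL.
have l0 : 0 < l by exact: lt_le_trans ql.
have h1 : L.-1%:R + 2 <= 3 * l / q by rewrite ler_pdivlMr // mulrDl mulrC; lra.
have h2 : n.+1%:R * (L.-1%:R + 2) <= 2 * n%:R * (3 * l / q).
  by apply: ler_pM => //; rewrite addr_ge0.
apply: le_trans h2 _.
have -> : 2 * n%:R * (3 * l / q) = 6 * n%:R * (l * q ^+ 2) / q ^+ 3.
  by field; rewrite gt_eqF.
have -> : 6 / q ^+ 3 * (n%:R * l ^+ 3) = 6 * n%:R * l ^+ 3 / q ^+ 3 by ring.
apply: ler_wpM2r; first by rewrite invr_ge0 exprn_ge0 // ltW.
apply: ler_wpM2l; first by rewrite mulr_ge0 // ltW.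
rewrite (exprS l); apply: ler_wpM2l; first exact: ltW.
by apply: lerXn2r => //; rewrite nnegrE ltW.
Qed.

Definition word_factor (N : nat) : nat := (11 + (2 * N + 2)).+1.

Lemma word_range_large N n : (2 <= n)%N ->
  (1000 * n.+1 <= word_range (word_factor N) n)%N /\
  (2 * N + 1 < word_range (word_factor N) n)%N.
Proof.
move=> n2; rewrite /word_range /word_factor mulSn expnD.
have /andP[_ up] := up_log_bounds (isT : (1 < 2)%N) n2.
have L0 : (0 < up_log 2 n)%N by rewrite up_log_gt0 // ltnW.
have h : (2048 * 2 ^ (2 * N + 2) <= 2 ^ ((11 + (2 * N + 2)) * up_log 2 n))%N.
  have -> : (2048 * 2 ^ (2 * N + 2) = 2 ^ (11 + (2 * N + 2)))%N by rewrite [RHS]expnD.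
  by rewrite leq_exp2l // leq_pmulr.
have h' : (2 * N + 2 < 2 ^ (2 * N + 2))%N by exact: ltn_expl.
move: (2 ^ up_log 2 n)%N (2 ^ (2 * N + 2))%N (2 ^ (_ * _))%N up h h' => a b c up h h'.
have ac1 : (n * 2048 <= a * c)%N by apply: leq_mul => //; lia.
have ac2 : (1 * b <= a * c)%N by apply: leq_mul; lia.
by split; lia.
Qed.

Section Main.
Variables (R : realType) (N : nat) (eps : R).
Hypotheses (N3 : (3 < N)%N) (eps0 : 0 < eps) (epsN : 48 <= eps * (N%:R - 3)).
Variables (s : seq 'rV[R]_3) (y : 'rV[R]_3).
Hypotheses (s_uniq : uniq s) (s2 : (2 <= size s)%N).
Local Notation n := (size s).
Local Notation W := (word_range (word_factor N) n).

Lemma program_run : exists m t,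
  [/\ dsteps W t (start (program N) s y) ([::], m),
     (t <= program_cost N n (up_log 2 n))%N &
     let a := output_point m 0 in let b := output_point m 1 in
     [/\ a \in s, b \in s, a != b &
       dist_line y a b <= (1 + eps) * min_induced_dist s y]].
Proof.
have [W_large N_W] := word_range_large N s2.
have /andP[_ nL] := up_log_bounds (isT : (1 < 2)%N) s2.
pose inp := real (input_mem s y).
suff [m [t [H le q]]] : wpm W (program N) (program_cost N n (up_log 2 n)) (fun m =>
     let a := output_point m 0 in let b := output_point m 1 in
     [/\ a \in s, b \in s, a != b &
       dist_line y a b <= (1 + eps) * min_induced_dist s y]) (input_mem s y).
  by exists m, t; split=> //; exact: H.
apply: wpm_seq.
apply: (wpm_conseq (leqnn _)) _ (wpm_prologue W_large (inp := inp) _ _) => // m1.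
move=> /abs_prologue[en1 y1 p1].
pose Y c := ra (abs m1) c n.+1; pose P := ra (abs m1).
have := wp_solve W_large N_W s2 (Y := Y) (P := P) nL en1 (fun c _ => erefl)
  (fun c e _ => erefl).
move=> /(_ m1 erefl); apply: (wpm_conseq (leqnn _)) => m2.
move=> [a [b [[ha hb ab] out near charts]]].
have PE e c : (0 < e <= n)%N -> (c < 3)%N -> P c e = s`_e.-1 0 (inord c).
  move=> he c3; rewrite /P p1 // /inp /= mulnC divnMDl // divn_small // addn0.
  by rewrite modnMDl modn_small //; case: e he.
have ptE e : (0 < e <= n)%N -> pt Y P e = s`_e.-1 - y.
  move=> he; apply/rowP => i; rewrite !mxE PE // /Y y1 // /inp /=.
  by rewrite divn_small // modn_small // inord_val.
have oE j e : (0 < e <= n)%N -> (forall c, (c < 3)%N -> real m2 (3 * j + c) = P c e) ->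
    output_point m2 j = s`_e.-1.
  by move=> he H; apply/rowP => i; rewrite !mxE H // PE // inord_val.
have -> : output_point m2 0 = s`_a.-1.
  apply: oE => // c c3; have [<- _] := out c c3.
  by rewrite /= (leq_trans c3).
have -> : output_point m2 1 = s`_b.-1.
  apply: oE => // c c3; have [_ <-] := out c c3.
  by rewrite /= ifT //; lia.
have pt_inj e f : (0 < e <= n)%N -> (0 < f <= n)%N -> pt Y P e = pt Y P f -> e = f.
  move=> he hf; rewrite !ptE // => /addIr/eqP.
  have [e0 f0] : (e.-1 < n)%N /\ (f.-1 < n)%N by lia.
  by rewrite nth_uniq // => /eqP; lia.
have sab e f : (0 < e <= n)%N -> (0 < f <= n)%N -> e != f -> s`_e.-1 != s`_f.-1.
  by move=> he hf ef; apply: contra ef => /eqP E; apply/eqP/pt_inj; rewrite ?ptE ?E.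
have mem e : (0 < e <= n)%N -> s`_e.-1 \in s.
  by move=> he; apply: mem_nth; rewrite prednK; case/andP: he.
split; [exact: mem|exact: mem|exact: sab|].
pose delta := line_dist (pt Y P a) (pt Y P b).
have dE e f : (0 < e <= n)%N -> (0 < f <= n)%N -> e != f ->
    dist_line y s`_e.-1 s`_f.-1 = line_dist (pt Y P e) (pt Y P f).
  by move=> he hf ef; rewrite !ptE // dist_lineE // sab.
rewrite dE // -/delta.
have bound e f : (0 < e <= n)%N -> (0 < f <= n)%N -> pt Y P e != pt Y P f ->
    delta <= (1 + eps) * line_dist (pt Y P e) (pt Y P f).
  apply: (dominated_line_dist N3 epsN (line_dist_ge0 _ _) pt_inj) => //.
  - move=> g hg; have [f' [hf' fg le]] := near g hg.
    apply: le_trans (line_dist_leP (q := pt Y P f') _).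
      exact: ler_wsqrtr.
    by apply: contraNneq fg => /pt_inj->.
  - move=> x xN; apply: dominated_pairs_mono (charts x xN) => c d le.
    exact: ler_wsqrtr.
have eps1 : 0 < 1 + eps by rewrite addr_gt0.
rewrite -ler_pdivrMl //; apply: lb_le_inf.
  by exists (dist_line y s`_a.-1 s`_b.-1), s`_a.-1, s`_b.-1; split; rewrite ?mem ?sab.
move=> d [p [q [ps qs pq ->]]].
have idx p' : p' \in s -> exists2 e, (0 < e <= n)%N & p' = s`_e.-1.
  by move=> h; exists (index p' s).+1; rewrite /= ?index_mem ?nth_index.
have [e he pe] := idx p ps; have [f hf qf] := idx q qs.
have ef : e != f by apply: contraNneq pq => E; rewrite pe qf E.
rewrite pe qf dE // ler_pdivrMl //; apply: bound => //.
by apply: contraNneq ef => /pt_inj->.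
Qed.

End Main.

Theorem theorem1 (R : realType) (eps : R) (heps : 0 < eps) :
  exists (P : cmd) (kappa : nat),
    approximates_nearest_line eps P kappa /\
    runs_in_whp (fun n : nat => n%:R * ln (n%:R : R) ^+ 3) P kappa.
Proof.
pose N := (Num.truncn (48 / eps)).+4.
have N3 : (3 < N)%N by [].
have epsN : 48 <= eps * (N%:R - 3).
  have h0 : 0 <= 48 / eps by rewrite divr_ge0 // ltW.
  have /andP[_ lt] := truncn_itv h0.
  have -> : (N%:R : R) - 3 = (Num.truncn (48 / eps)).+1%:R.
    by rewrite /N -addn3 natrD addrK.
  by rewrite -ler_pdivrMl // mulrC ltW.
exists (program N), (word_factor N); split.
  move=> s y m us s2 r; have [m' [t [H _ q]]] := program_run N3 heps epsN y us s2.
  by rewrite (returns_nil (dsteps_returns H r)).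
have [C HC] := quasilinear_program_cost N.
move=> c; exists (C%:R * (6 / ln (2 : R) ^+ 3)) => s y us s2.
have [m' [t [H le _]]] := program_run N3 heps epsN y us s2.
exists t; split.
  apply: le_trans (quasilinear_ln R C s2); rewrite ler_nat.
  exact: leq_trans le (HC _ _).
by rewrite (dsteps_halt H) lerBlDr lerDl invr_ge0 exprn_ge0.
Qed.
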